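(* Let $M$ be a simple matroid of rank $\ell$ on $[n]$ with Orlik–Solomon ideal $I$. Consider the following linear relations among the generators $z(T)$, $T\in\mathbf{nbc}_\ell$, of the annihilator ideal $I^0$. (1) For each $S\in\mathbf{nbc}'$ and each edge of the graph $\mathfrak t(S)$, with corresponding pair of close maximal flags $F=\mathcal F(S(a,k))=(X_0\subset\cdots\subset X_\ell)$ and $F'=\mathcal F(S(b,k+1))=(X_0'\subset\cdots\subset X'_\ell)$ differing exactly in rank $m$ (so $X_m\ne X_m'$ and $X_j=X_j'$ for $j\neq m$), the relation $$(e_\alpha-e_\beta)z(F)-(-1)^{|X_m|-|X_m'|}(e_{\alpha'}-e_{\beta'})z(F')=0,$$ where $\alpha=\min(X_m\setminus X_{m-1})$, $\beta=\min(X_{m+1}\setminus X_m)$, $\alpha'=\min(X'_m\setminus X'_{m-1})$, $\beta'=\min(X'_{m+1}\setminus X'_m)$, and where $z(F)$ and $z(F')$ are expressed through the $R$-basis $\{z(T)\mid T\in\mathbf{nbc}_\ell\}$ of $(I^0)_{n-\ell}$. (2) For each $T\in\mathbf{nbc}_\ell$, each part $A$ of the partition $\pi(T)$ and each $j\in A\setminus\{\min A\}$, the relation $(e_j-e_{\min A})z(T)=0$. Then the relations (1) and (2) together form an $R$-basis of the relation space $$\Big\{(v_T)_{T}\in (E_1)^{\mathbf{nbc}_\ell}\ \Big|\ \sum_{T\in\mathbf{nbc}_\ell}v_T\,z(T)=0\Big\}.$$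
   Context: $R$ is an arbitrary nonzero commutative ring with $1$. $M$ is a simple matroid (no loops, no nontrivial parallel classes) on $[n]=\{1,\dots,n\}$ of rank $\ell$; $cl$ is its closure operator and $X\vee Y=cl(X\cup Y)$. $E$ is the exterior algebra over $R$ on the free $R$-module with basis $e_1,\dots,e_n$, with the standard grading. For $S=\{i_1<\dots<i_p\}\subset[n]$ put $e_S=e_{i_1}\cdots e_{i_p}$ ($e_\emptyset=1$). $\partial:E\to E$ is the $R$-linear map of degree $-1$ with $\partial e_i=1$ and $\partial(ab)=(\partial a)b+(-1)^{\deg a}a\,\partial b$ for homogeneous $a$ and all $b$. $I$ is the ideal of $E$ generated by $\partial e_S$ for all dependent sets $S$ of $M$, and $I^0=\{a\in E\mid ab=0\ \forall b\in I\}$. A broken circuit is a circuit with its smallest element deleted; a set is $\mathbf{nbc}$ if it contains no broken circuit; $\mathbf{nbc}_p$ is the set of $\mathbf{nbc}$-sets of size $p$. Flags. For a maximal flag of flats $F=(X_0=\emptyset\subset X_1\subset\cdots\subset X_\ell=[n])$ put $S_i=X_i\setminus X_{i-1}$, $\pi(F)=\{S_1,\dots,S_\ell\}$ and $z(F)=\mathrm{sign}(\sigma)\partial(e_{S_1})\cdots\partial(e_{S_\ell})$, where $\sigma$ is the permutation of $[n]$ listing $S_1$, then $S_2$, ..., then $S_\ell$, each in increasing order. It is known that $z(F)\in(I^0)_{n-\ell}$. For an ordered base $U=(u_1,\dots,u_\ell)$ of $M$, $\mathcal F(U)$ is the maximal flag whose flat of rank $p$ is $cl(\{u_{\ell-p+1},\dots,u_\ell\})$.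 For $T\in\mathbf{nbc}_\ell$, written in increasing order, $\pi(T)=\pi(\mathcal F(T))$ and $z(T)=z(\mathcal F(T))$; the $z(T)$, $T\in\mathbf{nbc}_\ell$, form an $R$-basis of $(I^0)_{n-\ell}$, so an expression $v\,z(F)$ with $v\in E_1$, $z(F)=\sum_T c_Tz(T)$, $c_T\in R$, is read as the family $(c_Tv)_T$. Two maximal flags are close if they differ in at most one flat. Neat bases. For a maximal flag $F$, $\varphi(F)$ is the ordered base $(u_1,\dots,u_\ell)$ with $u_{\ell-p+1}=\min(X_p\setminus X_{p-1})$, $1\le p\le\ell$ (so $\mathcal F(\varphi(F))=F$). An ordered base $U$ is neat if $\varphi(\mathcal F(U))=U$. Graphs. $\mathbf{nbc}'$ is the set of $S\in\mathbf{nbc}_{\ell-1}$ contained in at least two members of $\mathbf{nbc}_\ell$. For $S=\{s_1<\dots<s_{\ell-1}\}\in\mathbf{nbc}'$ put $N(S)=\{i\in[n]\setminus S\mid S\cup\{i\}\in\mathbf{nbc}_\ell\}$, and for $a\in N(S)$, $1\le k\le\ell$, $S(a,k)=(s_1,\dots,s_{k-1},a,s_k,\dots,s_{\ell-1})$. $S(a,k)$ is early if $k=1$ or $a>s_{k-1}$. Put $X^k=cl(\{s_k,\dots,s_{\ell-1}\})$ ($X^\ell=\emptyset$). $\Gamma(S)$ is the graph whose vertices are the neat and early $S(a,k)$, with $S(a,k)$ and $S(b,k+1)$ joined by an edge iff $\{a\}\vee X^k=\{b\}\vee X^k$. $\mathfrak t(S)$ is the graph with vertex set $N(S)$ having an edge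 $\{a,b\}$, $a\neq b$, iff $S(a,k)$ and $S(b,k+1)$ (or the same with $a,b$ interchanged) are joined by an edge of $\Gamma(S)$ for some $k$; the corresponding pair of flags is $\mathcal F(S(a,k)),\mathcal F(S(b,k+1))$. *)

(* Defs.v *)
From HB Require Import structures.
From mathcomp Require Import all_boot all_order all_fingroup all_algebra.
From mathcomp Require classical_sets.
Set Implicit Arguments.
Unset Strict Implicit.
Unset Printing Implicit Defensive.
Import GRing.Theory.
Local Open Scope ring_scope.

Record matroid (n : nat) := Matroid {
  indep : {set {set 'I_n}};
  indep0 : set0 \in indep;
  indepS : forall A B : {set 'I_n}, A \subset B -> B \in indep -> A \in indep;
  indep_aug : forall A B : {set 'I_n},
    A \in indep -> B \in indep -> (#|A| < #|B|)%N ->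
    exists2 x, x \in B :\: A & x |: A \in indep
}.

Section Matroid.
Variables (n : nat) (M : matroid n).
Implicit Types (A B C S T X Y : {set 'I_n}) (U : seq 'I_n) (i j a b : 'I_n).

Definition loop i := [set i] \notin indep M.
Definition parallel i j :=
  [&& i != j, ~~ loop i, ~~ loop j & [set i; j] \notin indep M].
Definition simple_matroid :=
  (forall i, ~~ loop i) /\ (forall i j, ~~ parallel i j).

Definition mrk X : nat := \max_(A in indep M | A \subset X) #|A|.
Definition mrank : nat := mrk [set: 'I_n].
Definition mcl X : {set 'I_n} := [set i | mrk (i |: X) == mrk X].
Definition mjoin X Y := mcl (X :|: Y).

Definition circuit C := minset [pred D : {set 'I_n} | D \notin indep M] C.

(* [None] exactly for the empty set *)
Definition smin A : option 'I_n := [pick i in A | [forall j in A, (i <= j)%N]].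

Definition nbc : {set {set 'I_n}} :=
  [set S : {set 'I_n} | [forall C : {set 'I_n},
     circuit C ==> ~~ (C :\: [set i | Some i == smin C] \subset S)]].
Definition nbc_of_size p : {set {set 'I_n}} := [set S in nbc | #|S| == p].

(* A maximal flag X_0 < ... < X_l is represented by p |-> X_p, of which only *)
(* the values at p <= l matter.  An ordered base is a sequence, and the      *)
(* increasing enumeration of a set S of ordinals is [enum S].                *)
Definition flag := nat -> {set 'I_n}.
Implicit Types F G : flag.

Definition flag_of U : flag :=
  fun p => mcl [set x in drop (size U - p) U].

Definition part F p := F p :\: F p.-1.
Definition parts F : {set {set 'I_n}} := [set part F p.+1 | p : 'I_mrank].

Definition phi F : seq 'I_n :=
  pmap smin [seq part F p | p <- rev (iota 1 mrank)].
Definition neat U := phi (flag_of U) == U.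

(* meant for distinct close flags, where only one such m exists *)
Definition diff_rank F G := find (fun m => F m != G m) (iota 0 mrank.+1).

Definition nbc' : {set {set 'I_n}} :=
  [set S in nbc_of_size mrank.-1 |
    (2 <= #|[set T in nbc_of_size mrank | S \subset (T : {set 'I_n})]|)%N].
Definition N S := [set i | (i \notin S) && (i |: S \in nbc_of_size mrank)].

(* S(a,k), and X^k, with k counted from 1 *)
Definition insertion S a k : seq 'I_n :=
  take k.-1 (enum S) ++ a :: drop k.-1 (enum S).
Definition tail_flat S k := mcl [set x in drop k.-1 (enum S)].

Definition early S a k :=
  (k == 1) || (nth a (enum S) k.-2 < a)%N.

Definition Gamma_vertex S a k :=
  [&& a \in N S, (1 <= k <= mrank)%N, neat (insertion S a k) & early S a k].
(* S(a,k) and S(b,k+1) are joined by an edge of Gamma(S) *)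
Definition Gamma_edge S a b k :=
  [&& Gamma_vertex S a k, Gamma_vertex S b k.+1
    & mjoin [set a] (tail_flat S k) == mjoin [set b] (tail_flat S k)].

Definition t_adj S : rel 'I_n := fun a b =>
  [&& a \in N S, b \in N S, a != b
    & [exists k : 'I_mrank, Gamma_edge S a b k.+1 || Gamma_edge S b a k.+1]].
Definition t_edges S : {set {set 'I_n}} :=
  [set [set a; b] | a in 'I_n, b in 'I_n & t_adj S a b].

Definition nbc_base := {T : {set 'I_n} | T \in nbc_of_size mrank}.

Definition flag_of_base (T : nbc_base) : flag := flag_of (enum (val T)).

Definition edge_index := {x : {set 'I_n} * {set 'I_n} |
  (x.1 \in nbc') && (x.2 \in t_edges x.1)}.

Definition part_index := {x : nbc_base * {set 'I_n} * 'I_n |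
  [&& x.1.2 \in parts (flag_of_base x.1.1), x.2 \in x.1.2
    & Some x.2 != smin x.1.2]}.

End Matroid.

(* The exterior algebra, as the free module on the monomials e_S; lemmas     *)
(* [ext_monoE], [ext_gen_sqr], [ext_gen_anticomm] and, for the derivation    *)
(* [ext_der], [ext_der_gen] and [ext_derM] give the usual presentation.      *)
Definition exterior (R : comNzRingType) (n : nat) : Type :=
  {ffun {set 'I_n} -> R}.

HB.instance Definition _ (R : comNzRingType) (n : nat) :=
  GRing.Lmodule.copy (exterior R n) {ffun {set 'I_n} -> R^o}.

Section ExteriorAlgebra.
Variables (R : comNzRingType) (n : nat).
Local Notation E := (exterior R n).
Implicit Types (S T U V : {set 'I_n}) (a b c : E) (i j : 'I_n).

Definition inv_card S T : nat := \sum_(i in S) \sum_(j in T) (j < i)%N.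

(* e_S * e_T = esign S T *: e_(S :|: T) *)
Definition esign S T : R :=
  if [disjoint S & T] then (-1) ^+ inv_card S T else 0.

Definition ext_one : E := [ffun U => (U == set0)%:R].
Definition ext_mul a b : E :=
  [ffun U => \sum_S \sum_(T | S :|: T == U) esign S T * a S * b T].

Lemma inv_cardUl S T V : [disjoint S & T] ->
  inv_card (S :|: T) V = (inv_card S V + inv_card T V)%N.
Proof. move=> dST; rewrite /inv_card -bigU //=.
by apply: eq_bigl => i; rewrite !inE. Qed.

Lemma inv_cardUr S T V : [disjoint T & V] ->
  inv_card S (T :|: V) = (inv_card S T + inv_card S V)%N.
Proof.
move=> dTV; rewrite /inv_card -big_split /=; apply: eq_bigr => i _.
by rewrite -bigU //=; apply: eq_bigl => j; rewrite !inE.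
Qed.

Lemma esign_cocycle S T V :
  esign S T * esign (S :|: T) V = esign T V * esign S (T :|: V).
Proof.
rewrite /esign.
have -> : [disjoint S :|: T & V] = [disjoint S & V] && [disjoint T & V].
  by rewrite -!setI_eq0 setIUl setU_eq0.
have -> : [disjoint S & T :|: V] = [disjoint S & T] && [disjoint S & V].
  by rewrite -!setI_eq0 setIUr setU_eq0.
have [dST|] := boolP [disjoint S & T]; last by rewrite mul0r mulr0.
have [dTV|] := boolP [disjoint T & V]; last by rewrite andbF mul0r mulr0.
have [dSV|] := boolP [disjoint S & V]; last by rewrite !mulr0.
by rewrite inv_cardUl // inv_cardUr // -!exprD addnA addnC addnA.
Qed.

Lemma ext_addE a b U : (a + b : E) U = a U + b U.
Proof. exact: ffunE. Qed.

Lemma ext_scaleE (k : R) a U : (k *: a : E) U = k * a U.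
Proof. exact: ffunE. Qed.

Lemma ext_zeroE U : (0 : E) U = 0.
Proof. exact: ffunE. Qed.

Lemma ext_mulA : associative ext_mul.
Proof.
move=> a b c; apply/ffunP => U; rewrite !ffunE.
transitivity (\sum_S \sum_T \sum_(V | S :|: T :|: V == U)
   esign T V * esign S (T :|: V) * a S * b T * c V).
  apply: eq_bigr => S _.
  under eq_bigr => W _ do rewrite ffunE mulr_sumr.
  under eq_bigr => W _ do under eq_bigr => T _ do rewrite mulr_sumr.
  rewrite exchange_big /=; apply: eq_bigr => T _.
  rewrite (exchange_big_dep xpredT) //= [RHS]big_mkcond /=.
  apply: eq_bigr => V _; rewrite -setUA.
  case: ifP => h.
    rewrite (big_pred1 (T :|: V)).
      by rewrite !mulrA; do 2!congr (_ * _); rewrite mulrC mulrA.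
    by move=> W; rewrite [RHS]eq_sym andbC; case: eqP => //= <-.
  rewrite big_pred0 // => W; apply/negbTE/negP => /andP[/eqP hW /eqP hV].
  by rewrite hV hW eqxx in h.
symmetry.
under eq_bigr => W _ do under eq_bigr => V _ do
  rewrite ffunE mulr_sumr mulr_suml.
under eq_bigr => W _ do under eq_bigr => V _ do under eq_bigr => S _ do
  rewrite mulr_sumr mulr_suml.
under eq_bigr => W _ do rewrite exchange_big /=.
rewrite exchange_big /=; apply: eq_bigr => S _.
under eq_bigr => W _ do rewrite exchange_big /= big_mkcond /=.
rewrite exchange_big /=; apply: eq_bigr => T _.
rewrite -big_mkcond (big_pred1 (S :|: T)) => [|W]; last by rewrite eq_sym.
apply: eq_bigr => V _; rewrite -esign_cocycle !mulrA.
by rewrite [esign (S :|: T) V * _]mulrC.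
Qed.

Lemma ext_mul1l : left_id ext_one ext_mul.
Proof.
move=> a; apply/ffunP => U; rewrite ffunE (bigD1 set0) //= [X in _ + X]big1 ?addr0.
  rewrite (big_pred1 U) => [|T]; last by rewrite /= set0U.
  rewrite ffunE eqxx mulr1 /esign -setI_eq0 set0I eqxx /inv_card big_set0.
  by rewrite expr0 mul1r.
by move=> S /negbTE nS; rewrite big1 // => T _; rewrite ffunE nS mulr0 mul0r.
Qed.

Lemma ext_mul1r : right_id ext_one ext_mul.
Proof.
move=> a; apply/ffunP => U; rewrite ffunE.
rewrite (exchange_big_dep xpredT) //= (bigD1 set0) //= [X in _ + X]big1 ?addr0.
  rewrite (big_pred1 U) => [|T]; last by rewrite /= setU0.
  rewrite ffunE eqxx mulr1 /esign -setI_eq0 setI0 eqxx /inv_card.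
  by rewrite big1 ?mul1r // => i _; rewrite big_set0.
by move=> S /negbTE nS; rewrite big1 // => T _; rewrite ffunE nS mulr0.
Qed.

Lemma ext_mulDl : left_distributive ext_mul +%R.
Proof.
move=> a b c; apply/ffunP => U; rewrite ext_addE !ffunE -big_split /=.
apply: eq_bigr => S _; rewrite -big_split /=; apply: eq_bigr => T _.
by rewrite ext_addE mulrDr mulrDl.
Qed.

Lemma ext_mulDr : right_distributive ext_mul +%R.
Proof.
move=> a b c; apply/ffunP => U; rewrite ext_addE !ffunE -big_split /=.
apply: eq_bigr => S _; rewrite -big_split /=; apply: eq_bigr => T _.
by rewrite ext_addE mulrDr.
Qed.

Lemma ext_one_neq0 : ext_one != 0.
Proof.
apply/eqP => /ffunP/(_ set0)/eqP.
by rewrite ffunE ext_zeroE eqxx oner_eq0.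
Qed.

HB.instance Definition _ := GRing.Zmodule_isNzRing.Build E
  ext_mulA ext_mul1l ext_mul1r ext_mulDl ext_mulDr ext_one_neq0.

Lemma ext_mulE a b U :
  (a * b) U = \sum_S \sum_(T | S :|: T == U) esign S T * a S * b T.
Proof. exact: ffunE. Qed.

Lemma ext_scaleAl (k : R) a b : k *: (a * b) = (k *: a) * b.
Proof.
apply/ffunP => U; rewrite ext_scaleE !ext_mulE mulr_sumr.
apply: eq_bigr => S _; rewrite mulr_sumr; apply: eq_bigr => T _.
by rewrite ext_scaleE !mulrA [k * _]mulrC.
Qed.

HB.instance Definition _ := GRing.Lmodule_isLalgebra.Build R E ext_scaleAl.

Lemma ext_scaleAr (k : R) a b : k *: (a * b) = a * (k *: b).
Proof.
apply/ffunP => U; rewrite ext_scaleE !ext_mulE mulr_sumr.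
apply: eq_bigr => S _; rewrite mulr_sumr; apply: eq_bigr => T _.
by rewrite ext_scaleE mulrCA.
Qed.

HB.instance Definition _ := GRing.Lalgebra_isAlgebra.Build R E ext_scaleAr.

Definition ext_gen i : E := [ffun U => (U == [set i])%:R].
(* the factors are in increasing order *)
Definition ext_mono S : E := \prod_(i in S) ext_gen i.

Definition ext_homog p a := forall S, a S != 0 -> #|S| = p.

(* the linear map sending e_S to the alternating sum of the e_(S :\ i) *)
Definition ext_der a : E :=
  [ffun T : {set 'I_n} => \sum_(i | i \notin T)
     (-1) ^+ #|[set j in T | (j < i)%N]| * a (i |: T)].

Definition ext_basis S : E := [ffun U => (U == S)%:R].

Lemma ext_sumE (I : Type) (r : seq I) (P : pred I) (F : I -> E) U :
  (\sum_(i <- r | P i) F i) U = \sum_(i <- r | P i) F i U.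
Proof. by elim/big_rec2: _ => [|i x y _ <-]; rewrite ?ext_zeroE ?ext_addE. Qed.

Lemma ext_expand a : a = \sum_S a S *: ext_basis S.
Proof.
apply/ffunP => U; rewrite ext_sumE (bigD1 U) //= big1 ?addr0 => [|S nSU].
  by rewrite ext_scaleE ffunE eqxx mulr1.
by rewrite ext_scaleE ffunE eq_sym (negbTE nSU) mulr0.
Qed.

Lemma ext_mul_basis S T :
  ext_basis S * ext_basis T = esign S T *: ext_basis (S :|: T).
Proof.
apply/ffunP => U; rewrite ext_mulE ext_scaleE ffunE.
rewrite (bigD1 S) //= [X in _ + X]big1 ?addr0; last first.
  move=> V nV; rewrite big1 // => W _.
  by rewrite ffunE (negbTE nV) mulr0 mul0r.
rewrite big_mkcond (bigD1 T) //= big1 ?addr0 => [|W nW].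
  by rewrite !ffunE !eqxx !mulr1 eq_sym; case: eqP; rewrite ?mulr1 ?mulr0.
by rewrite !ffunE (negbTE nW) mulr0; case: ifP.
Qed.

Lemma ext_gen_sqr i : ext_gen i * ext_gen i = 0.
Proof.
rewrite [LHS]ext_mul_basis /esign -setI_eq0 setIid -cards_eq0 cards1.
by rewrite scale0r.
Qed.

Lemma ext_gen_anticomm i j :
  ext_gen i * ext_gen j = - (ext_gen j * ext_gen i).
Proof.
have [->|nij] := eqVneq i j; first by rewrite !ext_gen_sqr oppr0.
rewrite [LHS]ext_mul_basis [X in - X]ext_mul_basis setUC -scaleNr.
congr (_ *: _).
rewrite /esign !disjoints1 !inE [j == i]eq_sym nij.
rewrite /inv_card !big_set1; case: ltngtP => [||/val_inj eij];
  last by rewrite eij eqxx in nij.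
- by rewrite expr1.
- by rewrite expr1 opprK.
Qed.

Lemma ext_monoE S : ext_mono S = ext_basis S.
Proof.
have prodE (s : seq 'I_n) : sorted (fun i j : 'I_n => i < j)%N s ->
    \prod_(i <- s) ext_gen i = ext_basis [set x in s].
  elim: s => [|i s IHs] /= pis.
    rewrite big_nil (_ : [set x in [::]] = set0); last first.
      by apply/setP => x; rewrite !inE.
    exact: erefl.
  rewrite big_cons IHs ?(path_sorted pis) // [LHS]ext_mul_basis.
  have lt_i : all (fun j : 'I_n => i < j)%N s.
    by apply: order_path_min pis => x y z; apply: ltn_trans.
  have -> : [set x in i :: s] = i |: [set x in s].
    by apply/setP => x; rewrite !inE.
  rewrite /esign disjoints1 inE; case: ifP => [_|/negbFE i_s]; last first.
    by have /allP/(_ i i_s) := lt_i; rewrite ltnn.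
  rewrite /inv_card big_set1 big1 ?expr0 ?scale1r // => j; rewrite inE => j_s.
  by have /allP/(_ j j_s) := lt_i; rewrite ltnNge leq_eqVlt negb_or => /andP[_ /negbTE->].
rewrite /ext_mono -big_filter prodE.
  by congr ext_basis; apply/setP => i; rewrite inE mem_filter mem_index_enum andbT.
apply: sorted_filter; first by move=> x y z; apply: ltn_trans.
by have := iota_ltn_sorted 0 n; rewrite -val_enum_ord sorted_map enumT.
Qed.

Lemma ext_der_is_linear : linear ext_der.
Proof.
move=> k a b; apply/ffunP => U; rewrite ext_addE ext_scaleE !ffunE.
rewrite mulr_sumr -big_split /=; apply: eq_bigr => i _.
by rewrite ext_addE ext_scaleE mulrDr mulrCA.
Qed.

HB.instance Definition _ := GRing.isLinear.Build R E E _ ext_der ext_der_is_linear.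

Lemma ext_der_gen i : ext_der (ext_gen i) = 1.
Proof.
apply/ffunP => U; rewrite ffunE [RHS]ffunE.
have [->|nU] := eqVneq U set0.
  rewrite (bigD1 i) ?inE //= big1 ?addr0 => [|j /andP[_ nji]]; rewrite ffunE setU0.
    rewrite eqxx mulr1 (_ : [set j in set0 | _] = set0) ?cards0 //.
    by apply/setP => j; rewrite !inE.
  by rewrite (inj_eq set1_inj) (negbTE nji) mulr0.
rewrite big1 // => j jU; rewrite ffunE; case: eqP => [eji|]; last by rewrite mulr0.
have eij : j = i by apply/set1P; rewrite -eji setU11.
move: nU; case/set0Pn => x xU; have := setU1r j xU; rewrite eji inE => /eqP xi.
by rewrite -xi in eij; rewrite eij xU in jU.
Qed.

Definition card_lt i T : nat := #|[set j in T | (j < i)%N]|.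
Definition card_gt i T : nat := #|[set j in T | (i < j)%N]|.
Definition ext_contr i a : E :=
  [ffun T : {set 'I_n} => if i \in T then 0 else (-1) ^+ card_lt i T * a (i |: T)].

Lemma ext_contr_is_linear i : linear (ext_contr i).
Proof.
move=> k a b; apply/ffunP => U; rewrite ext_addE ext_scaleE !ffunE.
case: ifP => _; first by rewrite mulr0 addr0.
by rewrite mulrDr; congr (_ + _); apply: mulrCA.
Qed.

HB.instance Definition _ i :=
  GRing.isLinear.Build R E E _ (ext_contr i) (@ext_contr_is_linear i).

Lemma ext_der_contr a : ext_der a = \sum_i ext_contr i a.
Proof.
apply/ffunP => U; rewrite ext_sumE ffunE big_mkcond /=.
by apply: eq_bigr => i _; rewrite ffunE if_neg.
Qed.

Lemma ext_contr_notin i S : i \notin S -> ext_contr i (ext_basis S) = 0.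
Proof.
move=> iS; apply/ffunP => U; rewrite ffunE ext_zeroE ffunE; case: ifP => // _.
by case: eqP => [eS|]; rewrite ?mulr0 //; rewrite -eS setU11 in iS.
Qed.

Lemma ext_contr_in i S : i \notin S ->
  ext_contr i (ext_basis (i |: S)) = (-1) ^+ card_lt i S *: ext_basis S.
Proof.
move=> iS; apply/ffunP => U; rewrite ffunE ext_scaleE !ffunE.
case: ifPn => iU.
  by case: eqP => [eU|]; rewrite ?mulr0 //; rewrite -eU iU in iS.
have -> : (i |: U == i |: S) = (U == S).
  apply/eqP/eqP => [eUS|-> //].
  by rewrite -(setU1K iU) -(setU1K iS) eUS.
by case: eqP => [->|]; rewrite ?mulr0.
Qed.

Lemma esignUl i S T : i \notin S -> esign (i |: S) T =
  if i \in T then 0 else (-1) ^+ card_lt i T * esign S T.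
Proof.
move=> iS; rewrite /esign -setI_eq0 setIUl setU_eq0 !setI_eq0 disjoints1.
have [iT|iT] //= := boolP (i \in T); case: ifP; rewrite ?mulr0 // => _.
rewrite -exprD; congr (_ ^+ _); rewrite inv_cardUl ?disjoints1 //; congr (_ + _)%N.
rewrite /inv_card big_set1 /card_lt -sum1_card big_mkcond [RHS]big_mkcond.
by apply: eq_bigr => j _; rewrite !inE; case: (j \in T); case: ltngtP.
Qed.

Lemma esignUr i S T : i \notin T -> esign S (i |: T) =
  if i \in S then 0 else (-1) ^+ card_gt i S * esign S T.
Proof.
move=> iT; rewrite /esign disjoint_sym -setI_eq0 setIUl setU_eq0 !setI_eq0.
rewrite disjoints1 [X in _ && X]disjoint_sym.
have [iS|iS] //= := boolP (i \in S); case: ifP; rewrite ?mulr0 // => _.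
rewrite -exprD; congr (_ ^+ _); rewrite inv_cardUr ?disjoints1 //; congr (_ + _)%N.
rewrite /inv_card /card_gt -sum1_card big_mkcond [RHS]big_mkcond.
by apply: eq_bigr => j _; rewrite big_set1 !inE; case: (j \in S); case: ltngtP.
Qed.

Lemma card_lt_gt i S : i \notin S -> #|S| = (card_lt i S + card_gt i S)%N.
Proof.
move=> iS; rewrite /card_lt /card_gt -cardsUI.
rewrite [in X in (_ + X)%N]eq_card0 => [|j]; last first.
  by rewrite !inE; case: ltngtP; rewrite ?andbF.
rewrite addn0; apply: eq_card => j; rewrite !inE -andb_orr -neq_ltn.
have [/val_inj ->|ji] := eqVneq (nat_of_ord j) i; first by rewrite (negbTE iS).
by rewrite andbT.
Qed.

Lemma card_ltU i S T : [disjoint S & T] ->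
  card_lt i (S :|: T) = (card_lt i S + card_lt i T)%N.
Proof.
move=> /pred0P dST; rewrite /card_lt -cardsUI.
rewrite [in X in (_ + X)%N]eq_card0 => [|j]; last first.
  by have /= := dST j; rewrite !inE andbACA => ->.
by rewrite addn0; apply: eq_card => j; rewrite !inE andb_orl.
Qed.

Lemma esign_card_lt i S T :
  esign S T * (-1) ^+ card_lt i (S :|: T) = esign S T * (-1) ^+ (card_lt i S + card_lt i T).
Proof. by rewrite /esign; case: ifP => [/card_ltU ->|_]; rewrite ?mul0r. Qed.

Lemma ext_sqr_sign k : (-1) ^+ k * (-1) ^+ k = 1 :> R.
Proof. by rewrite -exprD addnn -mul2n exprM sqrrN expr1n expr1n. Qed.

Lemma ext_contrM_basis i S T :
  ext_contr i (ext_basis S * ext_basis T) =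
  ext_contr i (ext_basis S) * ext_basis T
  + (-1) ^+ #|S| *: (ext_basis S * ext_contr i (ext_basis T)).
Proof.
rewrite ext_mul_basis linearZ /=.
have [iS|iS] := boolP (i \in S); have [iT|iT] := boolP (i \in T).
- rewrite -(setD1K iS) -(setD1K iT); set S' := S :\ i; set T' := T :\ i.
  have iS' : i \notin S' by rewrite !inE eqxx.
  have iT' : i \notin T' by rewrite !inE eqxx.
  rewrite !ext_contr_in // -scalerAl -scalerAr !ext_mul_basis.
  rewrite esignUl // setU11 scale0r esignUr // (negbTE iS').
  rewrite esignUl // (negbTE iT') setUCA setUA !scalerA -scalerDl.
  rewrite cardsU1 iS' (card_lt_gt iS') !exprD expr1 mulN1r !mulNr !mulrA.
  by rewrite -[X in _ - X * _]mulrA ext_sqr_sign mulr1 subrr scale0r.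
- rewrite -(setD1K iS); set S' := S :\ i.
  have iS' : i \notin S' by rewrite !inE eqxx.
  rewrite ext_contr_in // [ext_contr i (ext_basis T)]ext_contr_notin //.
  rewrite mulr0 scaler0 addr0 -setUA ext_contr_in ?inE ?negb_or ?iT ?eqxx //.
  rewrite -scalerAl ext_mul_basis !scalerA esignUl // (negbTE iT) -mulrA.
  rewrite esign_card_lt exprD [_ * (_ * _)]mulrCA; congr (_ *: _).
  rewrite !mulrA [_ * esign _ _]mulrC -!mulrA; congr (_ * _).
  by rewrite mulrC -mulrA ext_sqr_sign mulr1.
- rewrite -(setD1K iT); set T' := T :\ i.
  have iT' : i \notin T' by rewrite !inE eqxx.
  rewrite ext_contr_in // [ext_contr i (ext_basis S)]ext_contr_notin //.
  rewrite mul0r add0r setUCA ext_contr_in ?inE ?negb_or ?iS ?eqxx //.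
  rewrite -scalerAr ext_mul_basis !scalerA esignUr // (negbTE iS) -[X in X *: _ = _]mulrA.
  rewrite esign_card_lt (card_lt_gt iS) !exprD; congr (_ *: _).
  by rewrite [esign _ _ * _]mulrC !mulrA [_ ^+ card_gt i S * _]mulrC.
- rewrite !ext_contr_notin ?mul0r ?mulr0 ?scaler0 ?addr0 //.
  by rewrite inE negb_or iS.
Qed.

Lemma ext_derM p a b : ext_homog p a ->
  ext_der (a * b) = ext_der a * b + (-1) ^+ p *: (a * ext_der b).
Proof.
move=> ha; rewrite !ext_der_contr mulr_suml mulr_sumr scaler_sumr -big_split.
apply: eq_bigr => i _ /=.
rewrite (ext_expand b) mulr_sumr !linear_sum !mulr_sumr scaler_sumr -big_split.
apply: eq_bigr => T _ /=; rewrite -!scalerAr !linearZ /= -!scalerAr.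
rewrite scalerA [_ * b T]mulrC -scalerA -scalerDr; congr (_ *: _).
rewrite [in LHS](ext_expand a) [in RHS](ext_expand a).
rewrite !mulr_suml !linear_sum !mulr_suml.
rewrite -big_split; apply: eq_bigr => S _ /=.
rewrite -scalerAl !linearZ /= -!scalerAl ext_contrM_basis scalerDr.
congr (_ + _); rewrite scalerA mulrC -scalerA.
by have [->|/ha <-//] := eqVneq (a S) 0; rewrite !scale0r !scaler0.
Qed.

End ExteriorAlgebra.

Section Relations.
Variables (R : comNzRingType) (n : nat) (M : matroid n).
Local Notation E := (exterior R n).
Local Notation nbcb := (nbc_base M).
Implicit Types (F G : flag n) (S e : {set 'I_n}).

(* the permutation whose one-line notation is S_1, S_2, ..., S_l *)
Definition flag_perm F : 'S_n :=
  odflt 1%g [pick s : 'S_n |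
    [seq s i | i <- enum 'I_n] ==
      flatten [seq enum (part F p) | p <- iota 1 (mrank M)]].

Definition z F : E :=
  (-1) ^+ odd_perm (flag_perm F) *:
    \prod_(1 <= p < (mrank M).+1) ext_der (ext_mono R (part F p)).

Definition z_base (T : nbcb) : E := z (flag_of_base T).

(* The coordinates of [a] in the basis of the z(T).  These are linearly      *)
(* independent, and their span, the degree n - l part of the annihilator of  *)
(* the Orlik-Solomon ideal, contains every z(F); the default value 0 plays   *)
(* no role.                                                                  *)
Definition zcoord (a : E) : {ffun nbcb -> R} :=
  classical_sets.xget (0 : {ffun nbcb -> R^o})
    (fun c : {ffun nbcb -> R} => a = \sum_T c T *: z_base T).

Definition gen_min (A : {set 'I_n}) : E := oapp (@ext_gen R n) 0 (smin A).

(* (-1)^(|X_m| - |X'_m|) is written (-1)^(|X_m| + |X'_m|) *)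
Definition close_rel F G : {ffun nbcb -> E} :=
  let m := diff_rank M F G in
  [ffun T => zcoord (z F) T *: (gen_min (part F m) - gen_min (part F m.+1))
     - (-1) ^+ (#|F m| + #|G m|) *:
       (zcoord (z G) T *: (gen_min (part G m) - gen_min (part G m.+1)))].

(* The edge e of t(S) arises from exactly one edge of Gamma(S): Gamma(S) is  *)
(* a tree with as many edges between S(a,k) and S(b,k+1), a != b, as t(S)    *)
(* has edges.                                                                *)
Definition edge_rel (x : edge_index M) : {ffun nbcb -> E} :=
  let: (S0, e) := val x in
  if [pick t : 'I_n * 'I_n * 'I_(mrank M) |
        [&& t.1.1 != t.1.2, e == [set t.1.1; t.1.2]
          & Gamma_edge M S0 t.1.1 t.1.2 t.2.+1]] is Some (a, b, k)
  then close_rel (flag_of M (insertion S0 a k.+1))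
                 (flag_of M (insertion S0 b k.+2))
  else 0.

Definition part_rel (x : part_index M) : {ffun nbcb -> E} :=
  let: (T0, A, j) := val x in
  [ffun T => if T == T0 then ext_gen R j - gen_min A else 0].

Definition is_relation (v : {ffun nbcb -> E}) : Prop :=
  (forall T, ext_homog 1 (v T)) /\ \sum_T v T * z_base T = 0.

End Relations.

Definition is_basis (R : nzRingType) (V : lmodType R) (I : finType)
    (W : V -> Prop) (r : I -> V) : Prop :=
  [/\ forall i, W (r i),
      forall c : I -> R, \sum_i c i *: r i = 0 -> forall i, c i = 0
    & forall v, W v -> exists c : I -> R, v = \sum_i c i *: r i].

(* Main.v *)
Require Import Defs.
From mathcomp Require Import all_boot all_order all_fingroup all_algebra.
From mathcomp Require Import zify ring.
From mathcomp Require classical_sets.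
Set Implicit Arguments.
Unset Strict Implicit.
Unset Printing Implicit Defensive.
Import GRing.Theory.
Local Open Scope ring_scope.

(** The coefficient of [z F] at the complement of [V] is a sign if [V] is a
    transversal of the parts of [F] and [0] otherwise.  The nbc bases are thus
    dual to the [z(T)]; and if the ordered base defining [F] is neat, then a
    transversal of its parts has element sum at least that of the base, with
    equality only for the base itself.

    Order the coordinates [(T, j)] of the families [v] with [v T] in [E_1] by
    [\sum T - j], ties being broken by [- j].  A relation (2) attached to
    [(T, A, j)] then has leading coordinate [(T, j)].  An edge between [S(a, k)] and
    [S(b, k+1)] with [a != b] satisfies [s_k < a < b], and its relation has leading
    coordinate [(S + b, b)].  The leading coefficients are signs and the leading
    coordinates are pairwise distinct, because [b] determines [a].  Every vertex of
    [Gamma(S)] above level 1 has a parent, so exactly one [x] in [N(S)], the root, is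
    not the larger end of an edge of [t(S)].  Hence the remaining coordinates are the
    [(S + x, x)] with [x] the root of [S], and evaluating [\sum_T v T * z(T)] at the
    complements of the sets [S] shows that a relation supported there vanishes. *)

(** * Closure and nbc sets *)

(** Over an arbitrary ring neither dimension counts nor division by nonzero elements are available.
    The basis property is therefore drawn from a triangular system whose leading coefficients are
    their own inverses, completed by a direct vanishing argument for relations that avoid every
    leading coordinate. Relation (1) holds because multiplication by [e_alpha - e_beta] merges two
    adjacent factors of [z F]: with [A], [B] the parts of ranks [m] and [m+1], the product
    [d(e_A) d(e_B)] becomes, up to sign, [d(e_A e_B)], which no longer sees [X_m]. The signs of the
    two flag permutations are compared by viewing each as the sign that reorders the product of the
    [e_{S_i}] into the top monomial. The weight comes from two bounds: a base [T] occurring in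
    [z(F)] has sum at least [\sum S + a], one occurring in [z(F')] at least [\sum S + b].
    Subtracting the index of the generator makes [(S + a, a)] and [(S + b, b)] tie at [\sum S], with
    all other nonzero coordinates strictly above; the tie-break on [- j] selects [b]. *)

Section Closure.
Variables (n : nat) (M : matroid n).
Implicit Types (A B C S T X Y : {set 'I_n}) (c x y : 'I_n).
Local Notation cl := (mcl M).
Local Notation rk := (mrk M).

Lemma leq_mrk A X : A \in indep M -> A \subset X -> (#|A| <= rk X)%N.
Proof. by move=> iA sA; rewrite /mrk (bigmax_sup A) ?iA. Qed.

Lemma mrk_basis A X : A \in indep M -> A \subset X ->
  exists B, [/\ B \in indep M, A \subset B, B \subset X & #|B| = rk X].
Proof.
move=> iA sA; have [C [iC sC eC]] : exists C, [/\ C \in indep M, C \subset X & #|C| = rk X].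
  have [|C /andP[iC sC] eC] := @eq_bigmax_cond _
      [pred C : {set 'I_n} | (C \in indep M) && (C \subset X)] (fun C => #|C|).
    by apply/card_gt0P; exists A; rewrite inE iA.
  by exists C; split=> //; rewrite -eC.
have [k] := ubnP (rk X - #|A|); elim: k => // k IHk in A iA sA *.
move=> lk; have [|lA] := leqP (rk X) #|A|.
  move=> le; exists A; split=> //; apply/eqP.
  by rewrite eqn_leq le leq_mrk.
have [|x /setDP[xC xA] ixA] := indep_aug iA iC; first by rewrite eC.
have [|||B [iB sB sBX eB]] := IHk (x |: A) => //.
- by rewrite subUset sub1set sA (subsetP sC).
- by move: lk lA; rewrite cardsU1 xA /=; lia.
by exists B; split=> //; apply: subset_trans sB; apply: subsetUr.
Qed.

Lemma mrkS X Y : X \subset Y -> (rk X <= rk Y)%N.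
Proof.
move=> sXY; have [B [iB _ sB <-]] := mrk_basis (indep0 M) (sub0set X).
exact: leq_mrk iB (subset_trans sB sXY).
Qed.

Lemma mrkU1_le x X : (rk (x |: X) <= (rk X).+1)%N.
Proof.
have [B [iB _ sB <-]] := mrk_basis (indep0 M) (sub0set (x |: X)).
have le : (#|B :\ x| <= rk X)%N.
  by rewrite leq_mrk ?subDset // (indepS _ iB) ?subD1set.
by rewrite (cardsD1 x B) (leq_add (leq_b1 _) le).
Qed.

Lemma mem_mcl x X : (x \in cl X) = (rk (x |: X) == rk X).
Proof. by rewrite inE. Qed.

Lemma sub_mcl X : X \subset cl X.
Proof. by apply/subsetP => x xX; rewrite mem_mcl setUC (setUidPl _) ?sub1set. Qed.

(** Extend a basis [B] of [X] to a basis [B'] of [Y]. If adjoining [x] raised the rank of [Y],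
    augmenting [B'] could only use [x] itself, so [x |: B] would be independent, against [x] in the
    closure of [X]. *)
Lemma mclS X Y : X \subset Y -> cl X \subset cl Y.
Proof.
move=> sXY; apply/subsetP => x; rewrite !mem_mcl => /eqP ex.
rewrite eqn_leq [X in _ && X]mrkS ?subsetUr // andbT leqNgt; apply/negP => lt.
have [B [iB _ sB eB]] := mrk_basis (indep0 M) (sub0set X).
have [B' [iB' sBB' sB' eB']] := mrk_basis iB (subset_trans sB sXY).
have [D [iD _ sD eD]] := mrk_basis (indep0 M) (sub0set (x |: Y)).
have [|y /setDP[yD yB'] iy] := indep_aug iB' iD; first by rewrite eD eB'.
have := subsetP sD _ yD; rewrite inE => /orP[/set1P eyx|yY]; last first.
  have := @leq_mrk (y |: B') Y iy.
  by rewrite subUset sub1set yY sB' cardsU1 yB' eB' => /(_ isT); rewrite ltnn.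
rewrite {}eyx {y yD} in yB' iy.
have ixB : x |: B \in indep M by rewrite (indepS _ iy) ?setUS.
have := leq_mrk ixB (setUS [set x] sB).
by rewrite cardsU1 (contra (subsetP sBB' x)) // ex eB ltnn.
Qed.

Lemma mrk_mcl X : rk (cl X) = rk X.
Proof.
suff H k : forall A, (#|A| <= k)%N -> A \subset cl X -> rk (X :|: A) = rk X.
  by have := H _ (cl X) (leqnn _) (subxx _); rewrite (setUidPr (sub_mcl X)).
elim: k => [|k IHk] A.
  by rewrite leqn0 cards_eq0 => /eqP-> _; rewrite setU0.
have [->|[x xA]] := set_0Vmem A; first by rewrite setU0.
rewrite (cardsD1 x) xA => lA sA.
have sAx := subset_trans (subD1set A x) sA.
rewrite -(IHk (A :\ x)) // -[in LHS](setD1K xA) setUCA; apply/eqP.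
by rewrite -mem_mcl (subsetP (mclS (subsetUl _ _))) ?(subsetP sA).
Qed.

Lemma mcl_subset X Y : X \subset cl Y -> cl X \subset cl Y.
Proof.
move=> sX; apply/subsetP => x xX; rewrite mem_mcl.
have : x \in cl (cl Y) by apply: (subsetP (mclS sX)).
rewrite mem_mcl mrk_mcl => /eqP ex; rewrite eqn_leq [X in _ && X]mrkS ?subsetUr //.
by rewrite andbT -ex mrkS ?setUS ?sub_mcl.
Qed.

Lemma mcl_exchange x y X : y \in cl (x |: X) -> y \notin cl X -> x \in cl (y |: X).
Proof.
move=> yx yX; have : (rk X < rk (y |: X))%N.
  by rewrite ltn_neqAle mrkS ?subsetUr // andbT eq_sym -mem_mcl.
have xX : x \notin cl X.
  apply: contra yX => xX; apply: (subsetP (mcl_subset _)) yx.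
  by rewrite subUset sub1set xX sub_mcl.
have : (rk X < rk (x |: X))%N.
  by rewrite ltn_neqAle mrkS ?subsetUr // andbT eq_sym -mem_mcl.
move: yx; rewrite !mem_mcl setUCA => /eqP->.
by move: (mrkU1_le x X) (mrkU1_le y X); lia.
Qed.

Lemma indep_rk A : (A \in indep M) = (rk A == #|A|).
Proof.
apply/idP/eqP => [iA|eA].
  apply/eqP; rewrite eqn_leq leq_mrk // andbT.
  by have [B [_ _ sB <-]] := mrk_basis (indep0 M) (sub0set A); apply: subset_leq_card.
have [B [iB _ sB eB]] := mrk_basis (indep0 M) (sub0set A).
suff <- : B = A by [].
by apply/eqP; rewrite eqEcard sB eB eA leqnn.
Qed.

Lemma indepU1 x A : A \in indep M -> x \notin cl A -> x |: A \in indep M.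
Proof.
move=> iA xA; have xnA : x \notin A by apply: contra xA; apply: (subsetP (sub_mcl A)).
move: iA xA; rewrite mem_mcl !indep_rk cardsU1 xnA add1n => /eqP eA ne.
by move: (mrkU1_le x A) (mrkS (subsetUr [set x] A)) ne; rewrite eA; lia.
Qed.

Lemma indep_notin_mcl x A : x |: A \in indep M -> x \notin A -> x \notin cl A.
Proof.
move=> ixA xA; have := indepS (subsetUr [set x] A) ixA.
move: ixA; rewrite mem_mcl !indep_rk cardsU1 xA => /eqP-> /eqP->.
by rewrite add1n neq_ltn ltnSn orbT.
Qed.

Lemma mcl_base A : A \in indep M -> #|A| = mrank M -> cl A = [set: 'I_n].
Proof.
move=> iA eA; apply/setP => x; rewrite mem_mcl !inE eqn_leq [X in _ && X]mrkS ?subsetUr //.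
move: iA; rewrite indep_rk => /eqP->; rewrite eA andbT.
exact/mrkS/subsetT.
Qed.

Definition above S c := [set x in S | (c < x)%N].

Lemma sminP A x : reflect (x \in A /\ forall y, y \in A -> (x <= y)%N) (smin A == Some x).
Proof.
rewrite /smin; case: pickP => [y /andP[yA /forall_inP yP]|none].
  apply: (iffP eqP) => [[<-] //|[xA xP]]; congr Some; apply: val_inj.
  by apply/eqP; rewrite eqn_leq yP ?xP.
constructor=> -[xA xP]; have := none x; rewrite xA => /negP; apply.
exact/forall_inP.
Qed.

Lemma smin_neq0 A : A != set0 -> exists x, smin A = Some x.
Proof.
case/set0Pn => x0 x0A.
have [x xA xP] := @arg_minnP _ x0 [in A] (@nat_of_ord n) x0A.
by exists x; apply/eqP/sminP.
Qed.

Lemma exists_circuit A : A \notin indep M -> exists2 C, circuit M C & C \subset A.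
Proof.
move=> dA; have [C mC sC] := @minset_exists _ [pred D : {set 'I_n} | D \notin indep M] A dA.
by exists C.
Qed.

Lemma circuit_min C : circuit M C ->
  exists2 c, smin C = Some c & c \in cl (C :\ c).
Proof.
move=> /minsetP[/= dC mC]; have [|c ec] := @smin_neq0 C.
  by apply: contraNneq dC => ->; apply: indep0.
exists c => //; have /sminP[cC _] := introT eqP ec.
apply: contraLR dC => nc; rewrite negbK -(setD1K cC) indepU1 //.
apply: contraT => /mC/(_ (subD1set _ _)) eC.
by move: cC; rewrite -eC setD11.
Qed.

Lemma nbc_indep S : S \in nbc M -> S \in indep M.
Proof.
rewrite inE => /forallP nS; apply: contraT => /exists_circuit[C cC sC].
have := nS C; rewrite cC /= => /negP[]; exact: subset_trans (subsetDl _ _) sC.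
Qed.

(** A dependence of [c] on the larger elements of [S] contains a circuit with minimum [c], hence a
    broken circuit inside [S]. Conversely, the minimum of a circuit lies in the closure of the rest,
    which consists of larger elements. All later uses of nbc sets go through this closure form. *)
Lemma nbcP S : reflect (forall c, c \notin cl (above S c)) (S \in nbc M).
Proof.
apply: (iffP idP) => [nS c|nS].
  have iS : above S c \in indep M.
    by apply: indepS (nbc_indep nS); apply/subsetP => x; rewrite inE => /andP[].
  apply/negP => cS; have cnS : c \notin above S c by rewrite inE ltnn andbF.
  have [|C cC sC] := @exists_circuit (c |: above S c).
    by apply: contraL cS => i; apply: indep_notin_mcl.
  have dC : C \notin indep M by have /minsetP[] := cC.
  have cinC : c \in C.
    apply: contraR dC => nc; apply: indepS iS; apply/subsetP => x xC.
    have := subsetP sC _ xC; rewrite in_setU1 => /orP[/eqP exc|//].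
    by rewrite -exc xC in nc.
  have ec : smin C = Some c.
    apply/eqP/sminP; split=> // y /(subsetP sC).
    by rewrite !inE => /orP[/eqP->//|/andP[_ /ltnW]].
  move: nS; rewrite inE => /forallP/(_ C); rewrite cC /= => /negP; apply.
  apply/subsetP => x; rewrite !inE ec => /andP[xc /(subsetP sC)].
  rewrite !inE => /orP[/eqP exc|/andP[] //].
  by rewrite exc eqxx in xc.
rewrite inE; apply/forallP => C; apply/implyP => cC; apply/negP => sC.
have [c ec cC'] := circuit_min cC; have /sminP[cinC cmin] := introT eqP ec.
move: (nS c); apply/negP; rewrite negbK; apply: (subsetP (mclS _)) cC'.
apply/subsetP => x; rewrite !inE => /andP[xc xC].
rewrite (subsetP sC) ?ltn_neqAle ?cmin ?andbT ?inE //.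
  by apply: contra xc => /eqP/val_inj->.
by rewrite xC andbT ec; apply: contra xc => /eqP[->].
Qed.

Lemma nbcS S T : S \subset T -> T \in nbc M -> S \in nbc M.
Proof.
move=> sST /nbcP nT; apply/nbcP => c; apply: contra (nT c).
apply/subsetP/mclS/subsetP => x; rewrite !inE => /andP[xS ->].
by rewrite (subsetP sST).
Qed.

Lemma nbc_below c S B : S \in nbc M -> B \subset S ->
  (forall x, x \in B -> (c < x)%N) -> c \notin cl B.
Proof.
move=> /nbcP/(_ c) + sB cB; apply: contra; apply/subsetP/mclS/subsetP => x xB.
by rewrite inE (subsetP sB) ?cB.
Qed.

End Closure.

(** * The exterior algebra *)

Section Exterior.
Variables (R : comNzRingType) (n : nat).
Local Notation E := (exterior R n).
Local Notation gen := (ext_gen R).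
Local Notation basis := (ext_basis R).
Implicit Types (A B S T U V : {set 'I_n}) (a b c : E) (i j x y : 'I_n).

Lemma ext_basisE S U : basis S U = (U == S)%:R.
Proof. exact: ffunE. Qed.

Lemma ext_oppE a U : (- a) U = - a U.
Proof. by rewrite -scaleN1r ext_scaleE mulN1r. Qed.

Lemma ext_gen_basis i : gen i = basis [set i].
Proof. by []. Qed.

Lemma ext_one_basis : 1 = basis set0 :> E.
Proof. by []. Qed.

Lemma ext_homogM p q a b : ext_homog p a -> ext_homog q b -> ext_homog (p + q) (a * b).
Proof.
move=> ha hb U; apply: contraNeq => nU; rewrite ext_mulE big1 // => S _.
rewrite big1 // => T /eqP eU; rewrite /esign; case: ifP => dST; rewrite ?mul0r //.
have [->|/ha eS] := eqVneq (a S) 0; first by rewrite mulr0 mul0r.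
have [->|/hb eT] := eqVneq (b T) 0; first by rewrite mulr0.
by move: nU; rewrite -eU cardsU (disjoint_setI0 dST) cards0 subn0 eS eT eqxx.
Qed.

Lemma ext_homog_basis S : ext_homog #|S| (basis S).
Proof. by move=> U; rewrite ext_basisE; case: (U =P S) => [->|]; rewrite ?eqxx. Qed.

Lemma ext_homog_der p a : ext_homog p a -> ext_homog p.-1 (ext_der a).
Proof.
move=> ha U; apply: contraNeq => nU; rewrite ffunE big1 // => i iU.
have [->|/ha] := eqVneq (a (i |: U)) 0; first by rewrite mulr0.
by rewrite cardsU1 iU add1n => ep; rewrite -ep eqxx in nU.
Qed.

Lemma ext_gen_comm p a x : ext_homog p a -> gen x * a = (-1) ^+ p *: (a * gen x).
Proof.
move=> ha; rewrite [in LHS](ext_expand a) [in RHS](ext_expand a).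
rewrite mulr_sumr mulr_suml scaler_sumr; apply: eq_bigr => S _.
have [->|/ha <-] := eqVneq (a S) 0; first by rewrite !scale0r mulr0 mul0r scaler0.
rewrite -scalerAr -scalerAl scalerA mulrC -scalerA; congr (_ *: _).
rewrite ext_gen_basis !ext_mul_basis scalerA setUC; congr (_ *: _).
have e1 T : esign R set0 T = 1.
  by rewrite /esign -setI_eq0 set0I eqxx /inv_card big_set0.
have e2 T : esign R T set0 = 1.
  by rewrite /esign -setI_eq0 setI0 eqxx /inv_card big1 // => ? _; rewrite big_set0.
rewrite -[[set x]]setU0 esignUl ?inE // esignUr ?inE // e1 e2.
case: ifPn => xS; first by rewrite mulr0.
by rewrite !mulr1 (card_lt_gt xS) exprD -mulrA ext_sqr_sign mulr1.
Qed.

Lemma ext_gen_mulE x b U :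
  (gen x * b) U = if x \in U then (-1) ^+ card_lt x (U :\ x) * b (U :\ x) else 0.
Proof.
rewrite ext_gen_basis ext_mulE (bigD1 [set x]) //= [X in _ + X]big1 ?addr0; last first.
  move=> S nS; rewrite big1 // => T _.
  by rewrite ext_basisE (negbTE nS) mulr0 mul0r.
have e1 T : esign R set0 T = 1.
  by rewrite /esign -setI_eq0 set0I eqxx /inv_card big_set0.
have es T : esign R [set x] T = if x \in T then 0 else (-1) ^+ card_lt x T.
  by rewrite -[[set x]]setU0 esignUl ?inE // e1 mulr1.
have [xU|xU] := boolP (x \in U); last first.
  rewrite big1 // => T /eqP eU; by rewrite -eU setU11 in xU.
rewrite (bigD1 (U :\ x)) /=; last by rewrite setD1K.
rewrite [X in _ + X]big1 ?addr0 => [|T /andP[/eqP eU nT]].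
  by rewrite es setD11 ext_basisE eqxx mulr1.
rewrite es; case: ifPn => xT; first by rewrite !mul0r.
by rewrite -eU setU1K ?eqxx in nT.
Qed.

(** With supports in disjoint sets, the monomial [U] factors in only one way, so a single term of
    the convolution survives. *)
Lemma ext_mul_supp A B a b : [disjoint A & B] ->
  (forall S, a S != 0 -> S \subset A) -> (forall S, b S != 0 -> S \subset B) ->
  forall U, (a * b) U = if U \subset A :|: B
    then esign R (U :&: A) (U :&: B) * a (U :&: A) * b (U :&: B) else 0.
Proof.
move=> dAB sa sb U.
have term S T : S :|: T == U -> esign R S T * a S * b T != 0 ->
    [/\ S = U :&: A, T = U :&: B & U \subset A :|: B].
  move=> /eqP<- h.
  have sS : S \subset A.
    by apply: sa; apply: contra_neq h => ->; rewrite mulr0 mul0r.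
  have sT : T \subset B.
    by apply: sb; apply: contra_neq h => ->; rewrite mulr0.
  have dSB : S :&: B = set0.
    apply/eqP; rewrite setI_eq0; exact: disjointWl sS dAB.
  have dTA : T :&: A = set0.
    apply/eqP; rewrite setI_eq0 disjoint_sym; exact: disjointWr sT dAB.
  split; rewrite ?setUSS // setIUl ?dSB ?dTA ?setU0 ?set0U.
    by rewrite (setIidPl sS).
  by rewrite (setIidPl sT).
rewrite ext_mulE; case: ifPn => sU; last first.
  rewrite big1 // => S _; rewrite big1 // => T eU; apply/eqP.
  by apply: contraNT sU => /term[].
rewrite (bigD1 (U :&: A)) //= [X in _ + X]big1 ?addr0 => [|S nS]; last first.
  rewrite big1 // => T eU; apply/eqP.
  by apply: contraNT nS => /term[]// ->.
rewrite (bigD1 (U :&: B)) /=; last by rewrite -setIUr (setIidPl sU).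
rewrite [X in _ + X]big1 ?addr0 // => T /andP[eU nT]; apply/eqP.
by apply: contraNT nT => /term[]// _ ->.
Qed.

Lemma ext_der_basis_supp A U : ext_der (basis A) U != 0 -> (U \subset A) && (#|A :\: U| == 1)%N.
Proof.
rewrite ffunE; apply: contraNT => nU; apply/eqP; rewrite big1 // => i iU.
rewrite ext_basisE; case: eqP => [eA|_]; last by rewrite mulr0.
move: nU; rewrite -eA subsetUr setDUl setDv setU0.
by rewrite (setDidPl _) ?disjoints1 // cards1.
Qed.

Lemma ext_der_basisE A U : U \subset A -> #|A :\: U| = 1%N ->
  exists k, ext_der (basis A) U = (-1) ^+ k.
Proof.
move=> sU /eqP/cards1P[i ei].
have iU : i \notin U by have := set11 i; rewrite -ei inE => /andP[].
have eA : A = i |: U by rewrite -(setID A U) ei setUC (setIidPr sU).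
exists #|[set j in U | (j < i)%N]|.
rewrite ffunE (bigD1 i) //= big1 ?addr0 => [|j /andP[jU nji]].
  by rewrite ext_basisE eA eqxx mulr1.
rewrite ext_basisE eA; case: eqP => [e|_]; last by rewrite mulr0.
have : j \in i |: U by rewrite -e setU11.
by rewrite in_setU1 (negbTE jU) orbF (negbTE nji).
Qed.

(** * Products of boundaries of disjoint sets *)

Definition ext_der_prod (s : seq {set 'I_n}) : E := \prod_(A <- s) ext_der (basis A).

Definition seq_cover (s : seq {set 'I_n}) := [set x | has (fun A : {set 'I_n} => x \in A) s].

Lemma seq_cover_cons A s : seq_cover (A :: s) = A :|: seq_cover s.
Proof. by apply/setP => x; rewrite !inE. Qed.

Lemma seq_cover_nil : seq_cover [::] = set0.
Proof. by apply/setP => x; rewrite !inE. Qed.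

Lemma seq_cover_sup A s : A \in s -> A \subset seq_cover s.
Proof. by move=> As; apply/subsetP => x xA; rewrite inE; apply/hasP; exists A. Qed.

Lemma seq_cover_disjoint A s :
  all (fun B => [disjoint A & B]) s -> [disjoint A & seq_cover s].
Proof.
move=> /allP dA; rewrite -setI_eq0; apply/eqP/setP => x; rewrite !inE.
apply/negP => /andP[xA /hasP[B Bs xB]].
by have /pred0P/(_ x) := dA _ Bs; rewrite /= xA xB.
Qed.

Lemma ext_der_prod_supp s : pairwise (fun A B : {set 'I_n} => [disjoint A & B]) s ->
  forall U, ext_der_prod s U != 0 ->
    U \subset seq_cover s /\ (forall A, A \in s -> #|A :\: U| = 1%N).
Proof.
elim: s => [|A s IHs] /= pw U.
  rewrite /ext_der_prod big_nil ext_one_basis ext_basisE seq_cover_nil.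
  by case: (U =P set0) => [->|]; rewrite ?eqxx // sub0set.
have /andP[dA {}/IHs IHs] := pw.
rewrite /ext_der_prod big_cons seq_cover_cons.
rewrite (@ext_mul_supp A (seq_cover s)) ?seq_cover_disjoint //; last 2 first.
- by move=> S /ext_der_basis_supp/andP[].
- by move=> S /IHs[].
case: ifP => [sU h|_]; last by rewrite eqxx.
split=> // B.
have [|_ hB] := IHs (U :&: seq_cover s).
  by apply: contra_neq h => ->; rewrite mulr0.
have /andP[_ /eqP hA] : (U :&: A \subset A) && (#|A :\: (U :&: A)| == 1)%N.
  by apply: ext_der_basis_supp; apply: contra_neq h => ->; rewrite mulr0 mul0r.
rewrite inE => /orP[/eqP->|Bs].
  by rewrite -hA setDIr setDv setU0.
by rewrite -(hB _ Bs) setDIr (_ : B :\: seq_cover s = set0) ?setU0 //;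
  apply/eqP; rewrite setD_eq0 seq_cover_sup.
Qed.

Lemma ext_der_prodE s : pairwise (fun A B : {set 'I_n} => [disjoint A & B]) s ->
  forall U, U \subset seq_cover s -> (forall A, A \in s -> #|A :\: U| = 1%N) ->
    exists k, ext_der_prod s U = (-1) ^+ k.
Proof.
elim: s => [|A s IHs] /= pw U.
  rewrite seq_cover_nil subset0 => /eqP-> _; exists 0%N.
  by rewrite /ext_der_prod big_nil ext_one_basis ext_basisE eqxx.
have /andP[dA pws] := pw; rewrite seq_cover_cons => sU hU.
rewrite /ext_der_prod big_cons.
rewrite (@ext_mul_supp A (seq_cover s)) ?seq_cover_disjoint //; last 2 first.
- by move=> S /ext_der_basis_supp/andP[].
- by move=> S /(ext_der_prod_supp pws)[].
rewrite sU; have [|B Bs|k2 ->] := IHs pws (U :&: seq_cover s).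
- exact: subsetIr.
- rewrite setDIr (_ : B :\: seq_cover s = set0) ?setU0 ?hU ?inE ?Bs ?orbT //.
  by apply/eqP; rewrite setD_eq0 seq_cover_sup.
have [||k1 ->] := @ext_der_basisE A (U :&: A).
- exact: subsetIr.
- by rewrite setDIr setDv setU0 hU ?inE ?eqxx.
rewrite /esign ifT; last first.
  by rewrite (disjointWl (subsetIr _ _)) // (disjointWr (subsetIr _ _)) // seq_cover_disjoint.
by rewrite -!exprD; eexists.
Qed.

(** Apply the derivation to [e_x e_A = 0]. *)
Lemma ext_gen_der_basis x A : x \in A -> gen x * ext_der (basis A) = basis A.
Proof.
move=> xA; have hx : ext_homog 1 (gen x).
  by rewrite -(cards1 x); apply: ext_homog_basis.
have := ext_derM (basis A) hx; rewrite ext_der_gen mul1r expr1 scaleN1r.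
rewrite ext_gen_basis ext_mul_basis /esign disjoints1 xA scale0r linear0.
by move/eqP; rewrite eq_sym subr_eq0 => /eqP <-.
Qed.

Lemma ext_der_one : ext_der (1 : E) = 0.
Proof.
apply/ffunP => U; rewrite [RHS]ext_zeroE ext_one_basis; apply/eqP.
by apply: contraT => /ext_der_basis_supp/andP[_]; rewrite set0D cards0.
Qed.

Lemma ext_der_der_basis A : ext_der (ext_der (basis A)) = 0.
Proof.
rewrite -ext_monoE /ext_mono; elim/big_rec: _ => [|x a _ IHa].
  by rewrite ext_der_one linear0.
have hx : ext_homog 1 (gen x) by rewrite -(cards1 x); apply: ext_homog_basis.
rewrite (ext_derM _ hx) ext_der_gen mul1r expr1 scaleN1r. rewrite linearD linearN /=.
by rewrite (ext_derM _ hx) ext_der_gen mul1r expr1 scaleN1r IHa mulr0 subr0 subrr.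
Qed.

Lemma ext_der_prod_homog s : exists p, ext_homog p (ext_der_prod s).
Proof.
rewrite /ext_der_prod; elim: s => [|A s [p hp]].
  by rewrite big_nil; exists 0%N; rewrite -(@cards0 'I_n); apply: ext_homog_basis.
rewrite big_cons; exists (#|A|.-1 + p)%N; apply: ext_homogM hp.
exact/ext_homog_der/ext_homog_basis.
Qed.

Lemma ext_der_der_prod s : ext_der (ext_der_prod s) = 0.
Proof.
rewrite /ext_der_prod; elim: s => [|A s IHs].
  by rewrite big_nil ext_der_one.
rewrite big_cons (ext_derM _ (ext_homog_der (@ext_homog_basis A))).
by rewrite ext_der_der_basis mul0r add0r IHs mulr0 scaler0.
Qed.

(* The left factor absorbs a derivative: [d(e_A e_B)] expands by the Leibniz rule
   and [e_x d(e_A) = e_A] for [x] in [A]. *)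
Lemma ext_der_mul_basis x y A B : x \in A -> y \in B ->
  (gen x - gen y) * (ext_der (basis A) * ext_der (basis B)) =
  (-1) ^+ #|A| *: ext_der (basis A * basis B).
Proof.
move=> xA yB; rewrite (ext_derM _ (@ext_homog_basis A)) scalerDr scalerA ext_sqr_sign scale1r.
rewrite mulrBl mulrA ext_gen_der_basis // [RHS]addrC; congr (_ + _).
rewrite mulrA (ext_gen_comm _ (ext_homog_der (@ext_homog_basis A))).
rewrite -scalerAl -mulrA ext_gen_der_basis // -scaleNr; congr (_ *: _).
by rewrite (cardsD1 x A) xA /= exprS mulN1r.
Qed.

(** * Ordered products of generators and signs of permutations *)

Definition gen_prod (s : seq 'I_n) : E := \prod_(x <- s) gen x.

Lemma gen_prod_cat s t : gen_prod (s ++ t) = gen_prod s * gen_prod t.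
Proof. exact: big_cat. Qed.

Lemma gen_prod_cons x s : gen_prod (x :: s) = gen x * gen_prod s.
Proof. exact: big_cons. Qed.

Lemma gen_prod_move x s : gen x * gen_prod s = (-1) ^+ size s *: (gen_prod s * gen x).
Proof.
elim: s => [|y s IHs]; first by rewrite /gen_prod big_nil mulr1 mul1r scale1r.
rewrite gen_prod_cons mulrA ext_gen_anticomm mulNr -!mulrA IHs /= exprS mulN1r.
by rewrite -scalerAr scaleNr.
Qed.

Lemma gen_prod_swap s1 x s2 y s3 :
  gen_prod (s1 ++ x :: s2 ++ y :: s3) = - gen_prod (s1 ++ y :: s2 ++ x :: s3).
Proof.
rewrite !gen_prod_cat !gen_prod_cons !gen_prod_cat !gen_prod_cons -mulrN; congr (_ * _).
rewrite !mulrA !gen_prod_move -!scalerAl -scalerN -!mulrA; congr (_ *: _).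
by rewrite -mulrN; congr (_ * _); rewrite !mulrA ext_gen_anticomm mulNr.
Qed.

Lemma gen_prod_tperm (s : 'S_n) x y : x != y ->
  gen_prod [seq (tperm x y * s)%g i | i <- enum 'I_n] = - gen_prod [seq s i | i <- enum 'I_n].
Proof.
move=> nxy; have ye : y \in enum 'I_n by rewrite mem_enum.
have xe : x \in enum 'I_n by rewrite mem_enum.
have out x' y' (q : seq 'I_n) : x' \notin q -> y' \notin q ->
    [seq (tperm x' y' * s)%g i | i <- q] = [seq s i | i <- q].
  move=> xq yq; apply/eq_in_map => i iq; rewrite permM tpermD //.
    by apply: contraNneq xq => ->.
  by apply: contraNneq yq => ->.
have swap x' y' q1 q2 q3 : uniq (q1 ++ x' :: q2 ++ y' :: q3) ->
    gen_prod [seq (tperm x' y' * s)%g i | i <- q1 ++ x' :: q2 ++ y' :: q3]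
    = - gen_prod [seq s i | i <- q1 ++ x' :: q2 ++ y' :: q3].
  move=> u; have : uniq (x' :: y' :: q1 ++ q2 ++ q3).
    rewrite (@perm_uniq _ _ (q1 ++ x' :: q2 ++ y' :: q3)) //.
    by apply/seq.permP => p; rewrite /= !count_cat /= !count_cat /=; lia.
  rewrite /= !inE !mem_cat !negb_or => /and3P[/and4P[_ x1 x2 x3] /and3P[y1 y2 y3] _].
  rewrite !map_cat /= !map_cat /= !out // !permM tpermL tpermR.
  exact: gen_prod_swap.
have := enum_uniq 'I_n; case/splitPr: xe ye => p1 p2.
rewrite mem_cat inE [y == x]eq_sym (negbTE nxy) /= => /orP[yp|yp] u.
  move: yp u; case/splitPr => q1 q2; rewrite -catA /= tpermC; exact: swap.
move: yp u; case/splitPr => q1 q2; exact: swap.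
Qed.

(** Each transposition in a decomposition of [s] flips the sign of the ordered product. This
    translates the permutation sign in [z] into a product inside the algebra. *)
Lemma gen_prod_perm (s : 'S_n) :
  gen_prod [seq s i | i <- enum 'I_n] = (-1) ^+ odd_perm s *: gen_prod (enum 'I_n).
Proof.
have [ts -> dts] := prod_tpermP s; elim: ts dts => [|t ts IHts] /= => [_|/andP[dt dts]].
  rewrite big_nil odd_perm1 scale1r; congr gen_prod; rewrite -[RHS]map_id.
  by apply: eq_map => i; rewrite perm1.
rewrite big_cons gen_prod_tperm // IHts // odd_mul_tperm dt -scaleNr.
by case: (odd_perm _); rewrite /= ?opprK.
Qed.

(** Ensures that the search in [flag_perm] succeeds, so that its default value is never met. *)
Lemma seq_perm (s : seq 'I_n) : perm_eq s (enum 'I_n) ->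
  exists p : 'S_n, [seq p i | i <- enum 'I_n] = s.
Proof.
move=> ps; have us : uniq s by rewrite (perm_uniq ps) enum_uniq.
have sz : size s = n by rewrite (perm_size ps) size_enum_ord.
pose f (i : 'I_n) := nth i s i.
have f_inj : injective f.
  move=> i j /eqP; rewrite /f (set_nth_default i) ?sz // nth_uniq ?sz // => /eqP e.
  exact: val_inj.
exists (perm f_inj); case: s sz @f f_inj {ps us} => [|x0 s] sz f f_inj.
  by apply: size0nil; rewrite size_map size_enum_ord.
apply: (@eq_from_nth _ x0) => [|i]; first by rewrite size_map size_enum_ord.
rewrite size_map size_enum_ord => i_n.
rewrite (nth_map x0) ?size_enum_ord // permE /f nth_enum_ord //.
by apply: set_nth_default; rewrite sz.
Qed.

Lemma ext_der_prod_cat s t : ext_der_prod (s ++ t) = ext_der_prod s * ext_der_prod t.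
Proof. exact: big_cat. Qed.

Lemma ext_der_prod_cons A s : ext_der_prod (A :: s) = ext_der (basis A) * ext_der_prod s.
Proof. exact: big_cons. Qed.

(** Every monomial of the product omits exactly one element of [A], hence meets [C] when [C]
    contains two of them; so the product kills [e_C]. Since the product is a cycle of the
    derivation, applying the derivation to this identity gives the claim. *)
Lemma ext_der_prod_kill s C A : pairwise (fun A B : {set 'I_n} => [disjoint A & B]) s ->
  A \in s -> (1 < #|A :&: C|)%N -> ext_der_prod s * ext_der (basis C) = 0.
Proof.
move=> pw As AC; have kill : ext_der_prod s * basis C = 0.
  apply/ffunP => U; rewrite ext_mulE ext_zeroE big1 // => S _; rewrite big1 // => T _.
  rewrite ext_basisE; case: (T =P C) => [->|_]; last by rewrite mulr0.
  rewrite /esign; case: ifP => [dSC|_]; last by rewrite !mul0r.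
  have [->|/(ext_der_prod_supp pw)[_ /(_ A As) h]] := eqVneq (ext_der_prod s S) 0.
    by rewrite mulr0 mul0r.
  suff : (#|A :&: C| <= 1)%N by rewrite leqNgt AC.
  rewrite -h subset_leq_card // subsetD subsetIl disjoint_sym.
  by apply: disjointWr dSC; apply: subsetIr.
have [p hp] := ext_der_prod_homog s.
have := ext_derM (basis C) hp; rewrite kill linear0 ext_der_der_prod mul0r add0r.
by move/(congr1 (fun a => (-1) ^+ p *: a)); rewrite scaler0 scalerA ext_sqr_sign scale1r.
Qed.

(** The top coefficient after multiplication by a monomial isolates one coefficient of [a]; this is
    how coefficients are extracted from equations of the form [a * d(e_C) = 0]. *)
Lemma ext_mul_basis_top a W : (a * basis W) setT = esign R (~: W) W * a (~: W).
Proof.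
rewrite (ext_expand a) mulr_suml !ext_sumE mulr_sumr; apply: eq_bigr => S _.
rewrite -scalerAl ext_mul_basis scalerA !ext_scaleE !ext_basisE.
case: (~: W =P S) => [<-|ne]; first by rewrite setUC setUCr eqxx !mulr1 mulrC.
rewrite !mulr0; case: (setT =P _) => [e|]; last by rewrite mulr0.
rewrite /esign; case: ifP => dSW; last by rewrite mulr0 mul0r.
case: ne; apply/setP => x; have /setP/(_ x) := e; rewrite !inE.
by have /pred0P/(_ x) /= := dSW; case: (x \in S); case: (x \in W).
Qed.

Lemma sign_mul_eq0 k (r : R) : (-1) ^+ k * r = 0 -> r = 0.
Proof. by move/(congr1 ( *%R ((-1) ^+ k))); rewrite mulrA ext_sqr_sign mul1r mulr0. Qed.

Lemma disjoint_setD B V : [disjoint B & V :\: B].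
Proof. by apply/pred0P => z; rewrite /= !inE; case: (z \in B). Qed.

(** Multiply the hypothesis by the monomial of [V :\: B] and read the top coefficient. In the
    boundary of [x |: B], the term omitting [x] contributes the coefficient of [a] at the complement
    of [V], up to sign; the term omitting [i] in [B] contributes the one where [i] has been traded
    for [x]. *)
Lemma ext_straighten a x B V : a * ext_der (basis (x |: B)) = 0 ->
  B \subset V -> x \notin V ->
  (forall i, i \in B -> a (~: (x |: (V :\ i))) = 0) -> a (~: V) = 0.
Proof.
move=> ax sBV xV h; have xB : x \notin B by apply: contra xV; apply: (subsetP sBV).
have : (a * ext_der (basis (x |: B)) * basis (V :\: B)) setT = 0.
  by rewrite ax mul0r ext_zeroE.
rewrite ext_der_contr mulr_sumr mulr_suml ext_sumE (bigD1 x) //= [X in _ + X]big1 ?addr0 =>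
  [|i nix].
  rewrite ext_contr_in // -scalerAr -scalerAl -mulrA ext_mul_basis -scalerAr scalerA.
  rewrite ext_scaleE (_ : B :|: V :\: B = V); last first.
    by rewrite -{2}(setID V B) (setIidPr sBV).
  rewrite ext_mul_basis_top /esign disjoint_setD disjoints_subset setCS subxx.
  by rewrite -exprD; do 2!move/sign_mul_eq0.
have [iB|iB] := boolP (i \in B); last first.
  by rewrite ext_contr_notin ?mulr0 ?mul0r ?ext_zeroE // in_setU1 negb_or nix.
rewrite (_ : x |: B = i |: (x |: (B :\ i))); last by rewrite setUCA setD1K.
rewrite ext_contr_in; last by rewrite !inE eqxx (negbTE nix).
rewrite -scalerAr -scalerAl -mulrA ext_mul_basis -scalerAr scalerA ext_scaleE.
rewrite ext_mul_basis_top (_ : x |: B :\ i :|: V :\: B = x |: V :\ i) ?h ?mulr0 //.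
apply/setP => z; rewrite !inE; case: eqP => //= _; case: (eqVneq z i) => [->|_] /=.
  by rewrite iB.
by have /implyP := subsetP sBV z; case: (z \in B); case: (z \in V).
Qed.

(** The right-hand side depends on [A] and [B] only through [A :|: B] and signs, which makes the
    elements of two close flags comparable. *)
Lemma ext_der_prod_close x y A B s1 s2 p : ext_homog p (ext_der_prod s1) ->
  x \in A -> y \in B ->
  (gen x - gen y) * ext_der_prod (s1 ++ A :: B :: s2) =
  (-1) ^+ (p + #|A|) *: (ext_der_prod s1 * ext_der (basis A * basis B) * ext_der_prod s2).
Proof.
move=> hp xA yB; rewrite ext_der_prod_cat !ext_der_prod_cons !mulrA.
rewrite mulrBl !(ext_gen_comm _ hp) -scalerBr -mulrBr -!scalerAl exprD -scalerA.
congr (_ *: _); rewrite -!mulrA scalerAr; congr (_ * _).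
by rewrite !mulrA -[_ * _ * ext_der (basis B)]mulrA ext_der_mul_basis // scalerAl.
Qed.

End Exterior.

(** * Flags of ordered bases *)

(** Flats are indexed below by the number of dropped base elements, so an induction from the empty
    flat upwards runs down from [ell]. *)
Lemma down_ind (P : nat -> Prop) m :
  P m -> (forall i, (i < m)%N -> P i.+1 -> P i) -> forall i, (i <= m)%N -> P i.
Proof.
move=> Pm step i le_im; rewrite -(subKn le_im).
elim: (m - i)%N (leq_subr i m) => [|d IHd] lt_dm; first by rewrite subn0.
by apply: step; [lia | rewrite subnSK //; apply: IHd; exact: ltnW].
Qed.

Lemma leq_add_eq (a b c d : nat) :
  (a <= b)%N -> (c <= d)%N -> (a + c = b + d)%N -> a = b /\ c = d.
Proof. by move=> *; lia. Qed.

Lemma pmap_full (A B : Type) (f : A -> option B) (s : seq A) (t : seq B) :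
  size t = size s -> pmap f s = t <-> map f s = map Some t.
Proof.
elim: s t => [|x s IHs] [|y t] //= [sz].
case fx: (f x) => [z|] /=; split=> //.
- by move=> [-> /(IHs _ sz)->].
- by move=> [-> /(IHs _ sz)->].
by move=> e; have := count_size f s; rewrite -size_pmap e /= sz ltnn.
Qed.

Section Flags.
Variables (n : nat) (M : matroid n) (M_simple : simple_matroid M).
Local Notation cl := (mcl M).
Local Notation ell := (mrank M).
Implicit Types (A B S T V X Y : {set 'I_n}) (U : seq 'I_n) (c x y : 'I_n).

Definition ordered_base U := [&& uniq U, size U == ell & [set x in U] \in indep M].

(** For an ordered base, [tail U i] has rank [ell - i] and [step U i] is the part of the flag in
    rank [ell - i]; it contains the [i]-th entry of [U], counted from 0. The condition [min_steps]
    is neatness, by [neatP]. *)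
Definition tail U i := cl [set x in drop i U].
Definition step U i := tail U i :\: tail U i.+1.
Definition min_steps U := forall i c, (i < ell)%N -> c \in step U i -> (nth c U i <= c)%N.
Definition flag_transversal U V := forall i, (i < ell)%N -> #|step U i :&: V| = 1%N.

Lemma mcl0 : cl set0 = set0.
Proof.
apply/setP => x; rewrite [RHS]inE; apply/negbTE.
have [h _] := M_simple; have := h x; rewrite /loop negbK => ix.
by have := @indep_notin_mcl _ M x set0; rewrite setU0 in_set0; apply.
Qed.

Section OneBase.
Variable U : seq 'I_n.
Hypothesis bU : ordered_base U.

Let uU : uniq U. Proof. by case/and3P: bU. Qed.
Let sU : size U = ell. Proof. by case/and3P: bU => _ /eqP. Qed.
Let iU : [set x in U] \in indep M. Proof. by case/and3P: bU. Qed.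

Lemma drop_base i x0 : (i < ell)%N ->
  [set x in drop i U] = nth x0 U i |: [set x in drop i.+1 U].
Proof. by move=> il; rewrite (drop_nth x0) ?sU //; apply/setP => x; rewrite !inE. Qed.

Lemma drop_ell : [set x in drop ell U] = set0.
Proof. by rewrite drop_oversize ?sU //; apply/setP => x; rewrite !inE. Qed.

Lemma tail_ell : tail U ell = set0.
Proof. by rewrite /tail drop_ell mcl0. Qed.

Lemma tail0 : tail U 0 = setT.
Proof.
by rewrite /tail drop0 mcl_base // cardsE; move/card_uniqP: uU => ->.
Qed.

Lemma indep_drop i : [set x in drop i U] \in indep M.
Proof. by apply: indepS iU; apply/subsetP => x; rewrite !inE; apply: mem_drop. Qed.

Lemma mem_step i x0 : (i < ell)%N -> nth x0 U i \in step U i.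
Proof.
move=> il; rewrite inE andbC (subsetP (sub_mcl _ _)) ?(drop_base x0 il) ?setU11 //=.
apply: indep_notin_mcl; first by rewrite -drop_base ?indep_drop.
by rewrite inE; have := drop_uniq i uU; rewrite (@drop_nth _ x0 i) ?sU //= => /andP[].
Qed.

Lemma tail_sub i j : (i <= j)%N -> tail U j \subset tail U i.
Proof.
move=> ij; apply/mclS/subsetP => x; rewrite !inE -(subnK ij) -drop_drop; exact: mem_drop.
Qed.

Lemma tailS i x0 : (i < ell)%N -> tail U i = cl (nth x0 U i |: tail U i.+1).
Proof.
move=> il; rewrite /tail (drop_base x0 il); apply/eqP; rewrite eqEsubset.
rewrite mclS ?setUS ?sub_mcl //= mcl_subset // subUset sub1set.
by rewrite (subsetP (sub_mcl _ _)) ?setU11 //= mclS ?subsetUr.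
Qed.

Lemma tail_split i : tail U i = step U i :|: tail U i.+1.
Proof. by rewrite setUC -[LHS](setID _ (tail U i.+1)) (setIidPr (tail_sub (leqnSn i))). Qed.

Lemma flag_of_tail p : flag_of M U p = tail U (ell - p).
Proof. by rewrite /flag_of sU. Qed.

Lemma part_step i : (i < ell)%N -> part (flag_of M U) (ell - i) = step U i.
Proof.
move=> il; rewrite /part !flag_of_tail subKn 1?ltnW //.
by rewrite (_ : (ell - (ell - i).-1)%N = i.+1) //; lia.
Qed.

(** Going up the flag, the unique element [v] of [V] in a step can replace the base element of that
    step by exchange, so the flat spanned by [V] grows together with the tail. *)
Lemma transversal_ind V i : flag_transversal U V -> (i <= ell)%N ->
  #|V :&: tail U i| = (ell - i)%N /\ cl (V :&: tail U i) = tail U i.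
Proof.
move=> tV; move: i; apply: down_ind => [|i il [IH1 IH2]].
  by rewrite tail_ell setI0 cards0 subnn mcl0.
have /eqP/cards1P[v ev] := tV i il.
have /setIP[vs vV] : v \in step U i :&: V by rewrite ev set11.
have /setDP[vi vi1] := vs.
have eV : V :&: tail U i = v |: (V :&: tail U i.+1).
  by rewrite tail_split setIUr [V :&: step U i]setIC ev.
rewrite eV cardsU1 in_setI negb_and vi1 orbT IH1; split; first by rewrite add1n subnSK.
apply/eqP; rewrite eqEsubset mcl_subset /=; last first.
  rewrite subUset sub1set vi; exact: subset_trans (subsetIr _ _) (tail_sub (leqnSn i)).
have u_in : nth v U i \in cl (v |: tail U i.+1).
  apply: mcl_exchange; first by rewrite -tailS.
  by apply: contra vi1; apply: (subsetP (mcl_subset (subxx _))).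
have sub1 : tail U i.+1 \subset cl (v |: V :&: tail U i.+1).
  by rewrite -{1}IH2 mclS ?subsetUr.
rewrite (tailS v il) mcl_subset // subUset sub1set sub1 andbT.
apply: (subsetP (mcl_subset _)) u_in.
by rewrite subUset sub1set sub1 (subsetP (sub_mcl _ _)) ?setU11.
Qed.

Lemma transversal_indep V : flag_transversal U V -> V \in indep M /\ #|V| = ell.
Proof.
move=> tV; have [] := transversal_ind tV (leq0n _).
rewrite tail0 setIT subn0 => eV clV; split=> //.
by rewrite indep_rk -mrk_mcl clV eV.
Qed.

(** A set meeting every step at most once is independent: going up the flag, each new element lies
    outside the flat that contains the previous ones. *)
Lemma dependent_step D : D \notin indep M -> exists2 i, (i < ell)%N & (1 < #|step U i :&: D|)%N.
Proof.
move=> dD; have [/exists_inP[i _ h]|/exists_inPn h] :=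
    boolP [exists i in 'I_ell, (1 < #|step U i :&: D|)%N]; first by exists i.
suff H i : (i <= ell)%N -> D :&: tail U i \in indep M.
  by have := H 0%N (leq0n _); rewrite tail0 setIT (negbTE dD).
move: i; apply: down_ind => [|i il IH]; first by rewrite tail_ell setI0 indep0.
rewrite tail_split setIUr [D :&: step U i]setIC.
have := h (Ordinal il) isT; rewrite -leqNgt /= => le1.
have [->|[x xs]] := set_0Vmem (step U i :&: D); first by rewrite set0U.
have -> : step U i :&: D = [set x].
  by apply/eqP; rewrite eq_sym eqEcard sub1set xs cards1.
apply: indepU1 => //; move: xs => /setIP[/setDP[_ xn] _].
by apply: contra xn; apply/subsetP/mcl_subset/subsetIr.
Qed.

Lemma transversal_sum V : min_steps U -> flag_transversal U V ->
  (\sum_(x in U) x <= \sum_(x in V) x)%N /\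
  ((\sum_(x in U) x)%N = (\sum_(x in V) x)%N -> V = [set x in U]).
Proof.
move=> mU tV.
suff H i : (i <= ell)%N ->
    (\sum_(x in [set x in drop i U]) x <= \sum_(x in V :&: tail U i) x)%N /\
    ((\sum_(x in [set x in drop i U]) x = \sum_(x in V :&: tail U i) x)%N ->
      V :&: tail U i = [set x in drop i U]).
  have [] := H 0%N (leq0n _); rewrite tail0 setIT drop0.
  by rewrite (eq_bigl (mem U)) // => x; rewrite inE.
move: i; apply: down_ind => [|i il [IH1 IH2]].
  by rewrite tail_ell setI0 drop_ell big_set0.
have /eqP/cards1P[v ev] := tV i il.
have /setIP[vs vV] : v \in step U i :&: V by rewrite ev set11.
have /setDP[vi vi1] := vs.
have eV : V :&: tail U i = v |: (V :&: tail U i.+1).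
  by rewrite tail_split setIUr [V :&: step U i]setIC ev.
have n1 : v \notin V :&: tail U i.+1 by rewrite in_setI negb_and vi1 orbT.
have n2 : nth v U i \notin [set x in drop i.+1 U].
  by rewrite inE; have := drop_uniq i uU; rewrite (@drop_nth _ v i) ?sU //= => /andP[].
rewrite eV (drop_base v il) (big_setU1 _ n1) (big_setU1 _ n2) /=.
have := mU i v il vs => le; split; first exact: leq_add.
case/(leq_add_eq le IH1) => /val_inj e1 e2.
by rewrite IH2 // e1.
Qed.

Lemma neatP : reflect (min_steps U) (neat M U).
Proof.
have eq_steps :
  [seq part (flag_of M U) p | p <- rev (iota 1 ell)] = [seq step U i | i <- iota 0 ell].
  rewrite map_rev; apply: (@eq_from_nth _ set0); rewrite ?size_rev !size_map ?size_iota // => i il.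
  rewrite nth_rev size_map size_iota // !(nth_map 0%N) ?size_iota ?nth_iota //; try lia.
  by rewrite -part_step //; congr part; lia.
have -> : neat M U = ([seq smin (step U i) | i <- iota 0 ell] == map Some U).
  rewrite /neat /phi eq_steps; apply/eqP/eqP.
    by move/pmap_full; rewrite -map_comp; apply; rewrite size_map size_iota sU.
  by move=> h; apply/pmap_full; rewrite ?size_map ?size_iota ?sU // -map_comp.
apply: (iffP eqP) => [e i c il ci|mU].
  have := congr1 (fun s => nth None s i) e.
  rewrite (nth_map 0%N) ?size_iota // nth_iota // (nth_map c) ?sU // => /eqP/sminP[_ h]; exact: h.
apply: (@eq_from_nth _ None) => [|i]; first by rewrite !size_map size_iota sU.
rewrite size_map size_iota => il.
have [x0] : inhabited 'I_n by move: sU il; case: (U) => [<- //|x s _ _]; exact: (inhabits x).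
rewrite (nth_map 0%N) ?size_iota // nth_iota // (nth_map x0) ?sU //.
apply/eqP/sminP; split=> [|c /(mU _ _ il)]; first exact: mem_step.
by rewrite (set_nth_default x0) ?sU.
Qed.

Lemma smin_step i x0 : min_steps U -> (i < ell)%N -> smin (step U i) = Some (nth x0 U i).
Proof.
move=> mU il; apply/eqP/sminP; split=> [|c /(mU _ _ il)]; first exact: mem_step.
by rewrite (set_nth_default x0) ?sU.
Qed.

Lemma transversal_self : flag_transversal U [set x in U].
Proof.
move=> i il; have [x0] : inhabited 'I_n.
  by move: sU il; case: (U) => [<- //|x s _ _]; exact: (inhabits x).
apply/eqP/cards1P; exists (nth x0 U i); apply/setP => x.
rewrite in_setI in_set1 [x \in [set x in U]]inE; apply/andP/eqP => [[xi xU]|->]; last first.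
  by rewrite mem_step ?mem_nth ?sU.
have := xU; rewrite -index_mem sU => il'; have ex : nth x0 U (index x U) = x by rewrite nth_index.
have /setDP[xt xnt] := xi; have [lt|lt|e] := ltngtP (index x U) i.
- have /setDP[_ /negP[]] := mem_step x0 il'; rewrite ex.
  exact: (subsetP (tail_sub lt)).
- case/negP: xnt; have /setDP[h _] := mem_step x0 il'; rewrite -ex.
  exact: (subsetP (tail_sub lt)).
- by rewrite -e ex.
Qed.

(** Listed by increasing rank, as the factors of [z], hence in the order opposite to the index of
    [step]. *)
Definition steps : seq {set 'I_n} := [seq part (flag_of M U) p | p <- iota 1 ell].

Lemma mem_steps A : reflect (exists2 i, (i < ell)%N & A = step U i) (A \in steps).
Proof.
apply: (iffP mapP) => [[p]|[i il ->]].
  rewrite mem_iota => /andP[p1 pl] ->; exists (ell - p)%N; first lia.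
  by rewrite -part_step ?subKn //; lia.
by exists (ell - i)%N; rewrite ?part_step // mem_iota; lia.
Qed.

Lemma step_disjoint i j : (i < j)%N -> [disjoint step U i & step U j].
Proof.
move=> ij; apply/pred0P => x /=; rewrite !in_setD; apply/negbTE/negP.
move=> /andP[/andP[xn _] /andP[_ xj]]; case/negP: xn.
exact: (subsetP (tail_sub ij)).
Qed.

Lemma steps_pairwise : pairwise (fun A B : {set 'I_n} => [disjoint A & B]) steps.
Proof.
rewrite /steps pairwise_map.
have /= := iota_ltn_sorted 1 ell; rewrite (sorted_pairwise ltn_trans).
apply: (@sub_in_pairwise _ [in iota 1 ell]); last exact/allP.
move=> p q pI qI pq; have [{}pI {}qI] : p \in iota 1 ell /\ q \in iota 1 ell by [].
move: pI qI; rewrite !mem_iota => /andP[p1 pl] /andP[q1 ql].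
have e r : (0 < r)%N -> (r < 1 + ell)%N -> part (flag_of M U) r = step U (ell - r).
  by move=> r1 rl; rewrite -part_step ?subKn //; lia.
by rewrite /= !e // disjoint_sym step_disjoint //; lia.
Qed.

Lemma steps_cover : seq_cover steps = setT.
Proof.
apply/setP => x; rewrite !inE; apply/hasP.
suff H i : (i <= ell)%N -> x \in tail U i -> exists2 A, A \in steps & x \in A.
  by apply: (H 0%N) => //; rewrite tail0 inE.
move: i; apply: down_ind => [|i il IH]; first by rewrite tail_ell inE.
rewrite tail_split in_setU => /orP[xi|/IH //].
by exists (step U i) => //; apply/mem_steps; exists i.
Qed.

End OneBase.

Lemma sorted_enum A : sorted (fun i j : 'I_n => i < j)%N (enum A).
Proof.
rewrite -[enum _](eq_filter (mem_enum _)) sorted_filter //.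
  by move=> x y z; apply: ltn_trans.
by have := iota_ltn_sorted 0 n; rewrite -val_enum_ord sorted_map enumT.
Qed.

Lemma enum_drop_leq A i x y : x \in drop i (enum A) -> (nth y (enum A) i <= x)%N.
Proof.
move=> xd; have lt : (i < size (enum A))%N.
  by rewrite ltnNge; apply: contraTN xd => /drop_oversize->.
move: xd; rewrite (drop_nth y lt) inE => /orP[/eqP->//|xd].
have := drop_sorted i (sorted_enum A); rewrite (drop_nth y lt) /= => h.
have tr : transitive (fun i j : 'I_n => i < j)%N by move=> ? ? ?; apply: ltn_trans.
by have /allP/(_ x xd)/ltnW := order_path_min tr h.
Qed.

Section Nbc.
Variable T : {set 'I_n}.
Hypothesis nT : T \in nbc_of_size M ell.

Let nbcT : T \in nbc M. Proof. by move: nT; rewrite inE => /andP[]. Qed.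
Let cardT : #|T| = ell. Proof. by move: nT; rewrite inE => /andP[_ /eqP]. Qed.

Lemma nbc_ordered_base : ordered_base (enum T).
Proof. by rewrite /ordered_base enum_uniq -cardE cardT eqxx set_enum nbc_indep. Qed.

(** Stronger than neatness: the entry is minimal in the whole flat, not only in its step, because a
    smaller [c] would lie in the closure of larger elements of an nbc set. *)
Lemma nbc_tail_min i c : c \in tail (enum T) i -> (nth c (enum T) i <= c)%N.
Proof.
apply: contraTT; rewrite -ltnNge => lt; apply: (nbc_below nbcT) => [|x].
  by apply/subsetP => x; rewrite inE => /mem_drop; rewrite mem_enum.
by rewrite inE => /(enum_drop_leq c); apply: leq_trans.
Qed.

Lemma nbc_min_steps : min_steps (enum T).
Proof. by move=> i c _ /setDP[/nbc_tail_min]. Qed.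

(** If [x] in [T] is missing from [V], the flat at [x] is spanned by the elements of [V] in it.
    These are at least [x] since [T] is nbc, hence larger than [x]; so [x] lies in the closure of
    larger elements of [V], which contradicts that [V] is nbc. *)
Lemma nbc_transversal V : V \in nbc_of_size M ell -> flag_transversal (enum T) V -> V = T.
Proof.
rewrite inE => /andP[nV /eqP cV] tV; apply/esym/eqP; rewrite eqEcard cV cardT leqnn andbT.
apply/subsetP => x; rewrite -mem_enum => xT; apply: contraT => xV.
have il : (index x (enum T) < ell)%N by rewrite -cardT cardE index_mem.
set i := index x (enum T) in il *; have ex : nth x (enum T) i = x by rewrite nth_index.
have [_ clV] := transversal_ind nbc_ordered_base tV (ltnW il).
have /setDP[xi _] := mem_step nbc_ordered_base x il.
move: xi; rewrite ex -clV => /negPn/negP[]; apply: (nbc_below nV); first exact: subsetIl.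
move=> y /setIP[yV /nbc_tail_min]; rewrite (set_nth_default x) -?cardE ?cardT // ex.
rewrite leq_eqVlt => /orP[/eqP/val_inj exy|//].
by rewrite exy yV in xV.
Qed.

End Nbc.
End Flags.

(** * The elements z(F) *)

Section FlagElements.
Variables (R : comNzRingType) (n : nat) (M : matroid n) (M_simple : simple_matroid M).
Local Notation E := (exterior R n).
Local Notation gen := (ext_gen R).
Local Notation basis := (ext_basis R).
Local Notation cl := (mcl M).
Local Notation ell := (mrank M).
Local Notation zU U := (z R M (flag_of M U)).
Implicit Types (A B S V X Y : {set 'I_n}) (U : seq 'I_n) (c x y : 'I_n) (T : nbc_base M).

Lemma z_steps U : zU U = (-1) ^+ odd_perm (flag_perm M (flag_of M U)) *: ext_der_prod R (steps M U).
Proof.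
rewrite /z /ext_der_prod /steps big_map /index_iota subSS subn0; congr (_ *: _).
by apply: eq_bigr => p _; rewrite ext_monoE.
Qed.

Lemma z_neq0 U W : ordered_base M U -> zU U W != 0 -> flag_transversal M U (~: W).
Proof.
move=> bU; rewrite z_steps ext_scaleE => h i il.
have nz : ext_der_prod R (steps M U) W != 0 by apply: contra_neq h => ->; rewrite mulr0.
have [_ hA] := ext_der_prod_supp (steps_pairwise bU) nz.
by rewrite -setDE hA //; apply/(mem_steps bU); exists i.
Qed.

Lemma z_transversal U V : ordered_base M U -> flag_transversal M U V ->
  exists k, zU U (~: V) = (-1) ^+ k.
Proof.
move=> bU tV; rewrite z_steps ext_scaleE.
have [||k ->] := ext_der_prodE R (steps_pairwise bU) (U := ~: V).
- by rewrite (steps_cover M_simple bU) subsetT.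
- by move=> A /(mem_steps bU)[i il ->]; rewrite setDE setCK tV.
by rewrite -exprD; eexists.
Qed.

Lemma z_dependent U D : ordered_base M U -> D \notin indep M -> zU U * ext_der (basis D) = 0.
Proof.
move=> bU dD; have [i il h] := dependent_step M_simple bU dD.
rewrite z_steps -scalerAl (ext_der_prod_kill _ (steps_pairwise bU) _ h) ?scaler0 //.
by apply/(mem_steps bU); exists i.
Qed.

Lemma nbc_baseP T : val T \in nbc_of_size M ell. Proof. exact: valP. Qed.

Lemma z_base_dual T T' : z_base R T (~: val T') != 0 -> T' = T.
Proof.
have bT := nbc_ordered_base (nbc_baseP T).
move=> /(z_neq0 bT); rewrite setCK => tT; apply: val_inj.
exact: nbc_transversal (nbc_baseP T) _ (nbc_baseP T') tT.
Qed.

Lemma z_base_unit T : exists k, z_base R T (~: val T) = (-1) ^+ k.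
Proof.
apply: z_transversal; first exact/nbc_ordered_base/nbc_baseP.
have := transversal_self (nbc_ordered_base (nbc_baseP T)).
by rewrite set_enum.
Qed.

Lemma z_base_coord (c : nbc_base M -> R) T :
  (\sum_T' c T' *: z_base R T') (~: val T) = c T * z_base R T (~: val T).
Proof.
rewrite ext_sumE (bigD1 T) //= big1 ?addr0 ?ext_scaleE // => T' nT'.
rewrite ext_scaleE; have [->|/z_base_dual e] := eqVneq (z_base R T' (~: val T)) 0.
  by rewrite mulr0.
by rewrite e eqxx in nT'.
Qed.

Lemma z_base_sqr T : z_base R T (~: val T) * z_base R T (~: val T) = 1.
Proof. by have [k ->] := z_base_unit T; rewrite ext_sqr_sign. Qed.

(* Straightening: an element killed by the boundaries of all dependent sets is
   determined by its coefficients at the complements of the nbc bases; if [V] is a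
   base but not nbc, some [x] lies in the closure of [B = above V x], and the
   boundary of [x |: B] trades the elements of [B] for the smaller [x]. *)
Lemma z_span U : ordered_base M U ->
  exists c : {ffun nbc_base M -> R}, zU U = \sum_T c T *: z_base R T.
Proof.
(* By duality the coordinate at [T] is a quotient of coefficients at the complement of [T]; the
   denominator is a sign, hence its own inverse. *)
move=> bU; pose c T := zU U (~: val T) * z_base R T (~: val T).
exists (finfun c); under eq_bigr do rewrite ffunE.
pose D := zU U - \sum_T c T *: z_base R T.
suff D0 W : D W = 0.
  by apply/eqP; rewrite -subr_eq0; apply/eqP/ffunP => W; rewrite ext_zeroE; apply: D0.
have Ddep A : A \notin indep M -> D * ext_der (basis A) = 0.
  move=> dA; rewrite mulrBl z_dependent // mulr_suml big1 ?subr0 // => T _.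
  by rewrite -scalerAl z_dependent ?scaler0 //; exact/nbc_ordered_base/nbc_baseP.
have Dsupp V : D (~: V) != 0 -> V \in indep M /\ #|V| = ell.
  move=> nz; have [zV|/(z_neq0 bU)] := eqVneq (zU U (~: V)) 0; last first.
    by rewrite setCK => /(transversal_indep M_simple bU).
  have [T nT] : exists T, z_base R T (~: V) != 0.
    apply/existsP; apply: contraNT nz => /existsPn h.
    rewrite ext_addE zV add0r ext_oppE ext_sumE big1 ?oppr0 // => T _.
    by rewrite ext_scaleE; have := h T; rewrite negbK => /eqP->; rewrite mulr0.
  have bT := nbc_ordered_base (nbc_baseP T).
  by move: nT => /(z_neq0 bT); rewrite setCK => /(transversal_indep M_simple bT).
have Dnbc T : D (~: val T) = 0.
  by rewrite ext_addE ext_oppE z_base_coord -mulrA z_base_sqr mulr1 subrr.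
rewrite -[W]setCK; move: (~: W) => V {W}.
have [k] := ubnP (\sum_(x in V) x)%N; elim: k => // k IHk in V *; rewrite ltnS => lek.
apply/eqP; apply: contraT => nz; have [iV cV] := Dsupp V nz.
have [nV|] := boolP (V \in nbc M).
  have hV : V \in nbc_of_size M ell by rewrite inE nV cV eqxx.
  by rewrite (Dnbc (Sub V hV)) eqxx in nz.
have [/forallP h|] := boolP [forall x, x \notin cl (above V x)].
  by move/nbcP; case.
rewrite negb_forall => /existsP[x]; rewrite negbK => xV _.
have sB : above V x \subset V by apply/subsetP => y; rewrite inE => /andP[].
have xA : x \notin above V x by rewrite inE ltnn andbF.
have dx : x |: above V x \notin indep M.
  by apply: contraL xV => i; apply: indep_notin_mcl.
have xnV : x \notin V.
  apply: contra dx => xV'; apply: indepS iV; by rewrite subUset sub1set xV'.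
case/eqP: nz; apply: (ext_straighten (Ddep _ dx) sB xnV) => i.
rewrite inE => /andP[iV' xi]; apply: IHk; apply: leq_trans lek.
rewrite (big_setD1 i iV') big_setU1 /=; last by rewrite !inE negb_and xnV orbT.
by rewrite ltn_add2r.
Qed.

Lemma zcoordP U : ordered_base M U -> zU U = \sum_T zcoord M (zU U) T *: z_base R T.
Proof. by move=> /z_span h; exact: (classical_sets.xgetPex 0 h). Qed.

Lemma zcoord_neq0 U T : ordered_base M U -> zcoord M (zU U) T != 0 -> flag_transversal M U (val T).
Proof.
move=> bU nz; rewrite -[val T]setCK; apply: (z_neq0 bU); apply: contra_neq nz.
rewrite (zcoordP bU) z_base_coord => /(congr1 ( *%R^~ (z_base R T (~: val T)))).
by rewrite -mulrA z_base_sqr mulr1 mul0r -zcoordP.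
Qed.

Lemma zcoord_unit U T : ordered_base M U -> flag_transversal M U (val T) ->
  exists k, zcoord M (zU U) T = (-1) ^+ k.
Proof.
move=> bU tT; have [k1 e1] := z_transversal bU tT; have [k2 e2] := z_base_unit T.
exists (k1 + k2)%N; rewrite exprD -e1 -e2 [X in _ = X * _](_ :
  _ = zcoord M (zU U) T * z_base R T (~: val T)).
  by rewrite -mulrA z_base_sqr mulr1.
by rewrite {1}(zcoordP bU) z_base_coord.
Qed.

Lemma gen_prod_enum A : gen_prod R (enum A) = basis A.
Proof.
by rewrite -ext_monoE /ext_mono -[RHS]big_filter; congr gen_prod.
Qed.

Lemma uniq_flatten_enum (s : seq {set 'I_n}) :
  pairwise (fun A B : {set 'I_n} => [disjoint A & B]) s -> uniq (flatten [seq enum A | A <- s]).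
Proof.
elim: s => //= A s IHs /andP[dA /IHs us]; rewrite cat_uniq enum_uniq us andbT /=.
apply/hasPn => x /flattenP[_ /mapP[B Bs ->]]; rewrite !mem_enum => xB; apply/negP => xA.
by have /pred0P/(_ x) := allP dA _ Bs; rewrite /= xA xB.
Qed.

(** The sign of the flag permutation is the sign that sorts the concatenation of the parts. In this
    form it can be compared between flags that share most of their parts. *)
Lemma steps_sign U : ordered_base M U ->
  \prod_(A <- steps M U) basis A = (-1) ^+ odd_perm (flag_perm M (flag_of M U)) *: basis setT.
Proof.
move=> bU; set L := flatten [seq enum A | A <- steps M U].
have pL : perm_eq L (enum 'I_n).
  apply: uniq_perm; rewrite ?enum_uniq //.
    exact/uniq_flatten_enum/steps_pairwise.
  move=> x; rewrite mem_enum inE; apply/flattenP.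
  have : x \in seq_cover (steps M U) by rewrite (steps_cover M_simple bU) inE.
  by rewrite inE => /hasP[A As xA]; exists (enum A); [exact: map_f | rewrite mem_enum].
have bT : gen_prod R (enum 'I_n) = basis setT.
  by rewrite -gen_prod_enum enum_setT enumT.
have bL : \prod_(A <- steps M U) basis A = gen_prod R L.
  rewrite /gen_prod /L big_flatten /= big_map; apply: eq_bigr => A _.
  by rewrite -gen_prod_enum.
rewrite bL -bT /flag_perm; case: pickP => [s /eqP|none].
  by move=> es; rewrite -gen_prod_perm; congr gen_prod; rewrite es /L /steps -map_comp.
have [s es] := seq_perm pL; have := none s; rewrite es /L /steps -map_comp.
by rewrite eqxx.
Qed.

(** Both sides are multiples of the same element, in which [A] and [B] are merged under one
    boundary. By [steps_sign] the permutation signs differ only through the signs of the products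
    [e_A e_B] and [e_A' e_B']. The exponent has the parity of the difference of the cardinalities of
    the two differing flats, as the flats just below them agree. *)
Lemma z_close U U' x y x' y' A B A' B' s1 s2 : ordered_base M U -> ordered_base M U' ->
  steps M U = s1 ++ A :: B :: s2 -> steps M U' = s1 ++ A' :: B' :: s2 ->
  A :|: B = A' :|: B' ->
  x \in A -> y \in B -> x' \in A' -> y' \in B' ->
  (gen x - gen y) * zU U = (-1) ^+ (#|A| + #|A'|) *: ((gen x' - gen y') * zU U').
Proof.
move=> bU bU' eU eU' eAB xA yB xA' yB'.
have [p hp] := ext_der_prod_homog R s1.
rewrite !z_steps eU eU' -!scalerAr !(ext_der_prod_close _ hp) //.
have dAB (V : seq 'I_n) (C D : {set 'I_n}) : ordered_base M V ->
  steps M V = s1 ++ C :: D :: s2 -> [disjoint C & D].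
  move=> bV eV; have := steps_pairwise bV; rewrite eV pairwise_cat /= => /and3P[_ _].
  by move=> /andP[/andP[]].
rewrite !ext_mul_basis -eAB !linearZ /= -!scalerAr -!scalerAl !scalerA; congr (_ *: _).
have top (V : seq 'I_n) (C D : {set 'I_n}) : ordered_base M V -> steps M V = s1 ++ C :: D :: s2 ->
    (-1) ^+ odd_perm (flag_perm M (flag_of M V)) *: basis setT =
    esign R C D *: (\prod_(S <- s1) basis S * (basis (C :|: D) * \prod_(S <- s2) basis S)).
  move=> bV eV; rewrite -steps_sign // eV big_cat big_cons big_cons /=.
  by rewrite [X in _ * X]mulrA ext_mul_basis -scalerAl -scalerAr.
have := top _ _ _ bU' eU'; have := top _ _ _ bU eU; rewrite -eAB.
(* [P] is the product of the common parts with [A :|: B], the same for both flags; its top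
   coefficient carries both permutation signs. *)
move: (_ * (_ * _)) => P.
rewrite /esign (dAB _ _ _ bU eU) (dAB _ _ _ bU' eU').
move=> /(congr1 (fun a : E => a setT)); rewrite !ext_scaleE ext_basisE eqxx mulr1 => ->.
move=> /(congr1 (fun a : E => a setT)); rewrite !ext_scaleE ext_basisE eqxx mulr1 => ->.
move: (P setT) (inv_card A B) (inv_card A' B') => q i j.
transitivity ((-1) ^+ (p + #|A|) * q * ((-1) ^+ i * (-1) ^+ i)); first ring.
transitivity ((-1) ^+ (p + #|A|) * q * ((-1) ^+ #|A'| * (-1) ^+ #|A'|)
   * ((-1) ^+ j * (-1) ^+ j)); last by rewrite !exprD; ring.
by rewrite !ext_sqr_sign !mulr1.
Qed.

End FlagElements.

(** * The graph Gamma(S) *)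

#[local] Opaque mcl mrk nbc z zcoord.

Lemma addn_subnS i k : (k < i)%N -> (k + (i - k.+1))%N = i.-1.
Proof. by move=> *; lia. Qed.

Section Graph.
Variables (n : nat) (M : matroid n) (M_simple : simple_matroid M).
Local Notation cl := (mcl M).
Local Notation ell := (mrank M).
Variable S : {set 'I_n}.
Hypothesis nS : S \in nbc_of_size M ell.-1.
Local Notation s := (enum S).
(** Positions are counted from 0: [S(a, k+1)] has [a] at index [k], and [D k] generates the flat
    [X^{k+1}]. *)
Local Notation D k := [set x in drop k s].
Implicit Types (a b c x y : 'I_n).

Let nbc_S : S \in nbc M. Proof. by move: nS; rewrite inE => /andP[]. Qed.
Let sz : size s = ell.-1. Proof. by move: nS; rewrite inE -cardE => /andP[_ /eqP]. Qed.

Lemma tailset_sub k : D k \subset S.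
Proof. by apply/subsetP => x; rewrite inE => /mem_drop; rewrite mem_enum. Qed.

Lemma tailset_subS i j : (i <= j)%N -> D j \subset D i.
Proof. by move=> ij; apply/subsetP => x; rewrite !inE -(subnK ij) -drop_drop; exact: mem_drop. Qed.

Lemma memN a : a \in N M S ->
  [/\ a \notin S, a |: S \in nbc M, a |: S \in nbc_of_size M ell, (0 < ell)%N
    & forall k, a \notin cl (D k)].
Proof.
rewrite inE => /andP[aS aSn]; have := aSn; rewrite inE => /andP[nbc_aS /eqP card_aS].
split=> //.
- by rewrite nbc_aS card_aS eqxx.
- by rewrite -card_aS cardsU1 aS.
move=> k; have := indep_notin_mcl (nbc_indep nbc_aS) aS; apply: contra.
by apply/subsetP/mclS/tailset_sub.
Qed.

Lemma insertionE a k : insertion S a k.+1 = take k s ++ a :: drop k s.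
Proof. by []. Qed.

Lemma insertion_base a k : a \in N M S -> ordered_base M (insertion S a k.+1).
Proof.
move=> /memN[aS naS _ l0 _]; have p : perm_eq (insertion S a k.+1) (a :: s).
  by rewrite insertionE -cat1s perm_catCA /= perm_cons cat_take_drop.
have e : [set x in insertion S a k.+1] = a |: S.
  by apply/setP => x; rewrite !inE (perm_mem p) inE mem_enum.
rewrite /ordered_base (perm_uniq p) (perm_size p) e /= mem_enum aS enum_uniq sz prednK //.
by rewrite eqxx nbc_indep.
Qed.

Lemma drop_insertion a k i : (k < ell)%N ->
  [set x in drop i (insertion S a k.+1)] = if (i <= k)%N then a |: D i else D i.-1.
Proof.
move=> kl; have stk :
  size (take k s) = k by rewrite size_takel // sz -ltnS prednK // (leq_ltn_trans _ kl).
rewrite insertionE drop_cat stk; have [lt|lt|->] := ltngtP i k.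
- apply/setP => x; rewrite !inE mem_cat inE orbCA; congr (_ || _).
  by rewrite -{3}(cat_take_drop k s) drop_cat stk lt mem_cat.
- rewrite -(subnSK lt) /= drop_drop; apply/setP => x; rewrite !inE.
  by rewrite addnC addn_subnS.
- by rewrite subnn drop0; apply/setP => x; rewrite !inE.
Qed.

Lemma nth_insertion x0 a k i : (k < ell)%N -> nth x0 (insertion S a k.+1) i =
  if (i < k)%N then nth x0 s i else if i == k then a else nth x0 s i.-1.
Proof.
move=> kl; have stk :
  size (take k s) = k by rewrite size_takel // sz -ltnS prednK // (leq_ltn_trans _ kl).
rewrite insertionE nth_cat stk; case: ltngtP => [lt|lt|->].
- by rewrite nth_take.
- by rewrite -(subnSK lt) /= nth_drop addn_subnS.
- by rewrite subnn.
Qed.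

Lemma nth_enum_leq x0 i j : (i <= j)%N -> (j < ell.-1)%N -> (nth x0 s i <= nth x0 s j)%N.
Proof.
move=> ij jl; apply: enum_drop_leq; rewrite -(subnK ij) addnC -nth_drop mem_nth //.
by rewrite size_drop sz ltn_sub2r // (leq_ltn_trans ij).
Qed.

Lemma tailset_leq x0 k x : x \in D k -> (nth x0 s k <= x)%N.
Proof. by rewrite inE; apply: enum_drop_leq. Qed.

Lemma tailset_cons x0 k : (k < ell.-1)%N -> D k = nth x0 s k |: D k.+1.
Proof. by move=> kl; apply/setP => x; rewrite (drop_nth x0) ?sz // !inE. Qed.

Lemma nth_in_tailset x0 k : (k < ell.-1)%N -> nth x0 s k \in D k.
Proof. by move=> kl; rewrite (tailset_cons x0) // setU11. Qed.

Lemma early_lt a k i : early S a k.+1 -> (i < k)%N -> (k < ell)%N -> (nth a s i < a)%N.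
Proof.
rewrite /early /=; case: k => // k /= lt ik kl.
by apply: leq_ltn_trans lt; apply: (nth_enum_leq _ (ltnSE ik)); rewrite ltn_predRL.
Qed.

Lemma mem_tailset x0 k x : (k < ell.-1)%N -> x \in S -> (nth x0 s k < x)%N -> x \in D k.
Proof.
move=> kl; rewrite -mem_enum -{1}(cat_take_drop k s) mem_cat inE => /orP[|//].
move=> /(nthP x0)[i]; rewrite size_takel; last by rewrite sz ltnW.
move=> ik.
by rewrite nth_take // => <-; rewrite ltnNge (nth_enum_leq _ (ltnW ik)).
Qed.

Definition min_over a k := forall c, c \in cl (a |: D k) -> c \notin cl (D k) -> (a <= c)%N.

(** For an early insertion, neatness is a condition at the new element only. At entries before [a]
    it follows from [a |: S] being nbc, since such an entry is smaller than [a] and than the later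
    entries; at entries after [a] it follows from [S] being nbc. *)
Lemma vertexP a k : a \in N M S -> (k < ell)%N -> early S a k.+1 ->
  neat M (insertion S a k.+1) <-> min_over a k.
Proof.
move=> aN kl ea; have bU := insertion_base k aN; have [aS naS _ _ an] := memN aN.
have sE i : step M (insertion S a k.+1) i = cl (if (i <= k)%N then a |: D i else D i.-1)
    :\: cl (if (i < k)%N then a |: D i.+1 else D i).
  by rewrite /step /tail !drop_insertion.
split=> [/(neatP bU) mU c ci cn|mk].
  have := mU k c kl; rewrite sE leqnn ltnn nth_insertion // ltnn eqxx; apply.
  by rewrite in_setD ci cn.
apply/(neatP bU) => i c il; rewrite sE nth_insertion // => /setDP[ci cn].
case: ltngtP ci cn => [ik|ik|->] ci cn.
- rewrite leqNgt; apply: contraL ci => lt; apply: (nbc_below naS);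
  first by rewrite setUS ?tailset_sub.
  move=> x; rewrite in_setU1 => /orP[/eqP->|/(tailset_leq c)]; last exact: leq_trans.
  by apply: ltn_trans lt _;
    rewrite (set_nth_default a) ?(early_lt ea ik kl) // sz ltn_predRL (leq_ltn_trans _ kl).
- rewrite leqNgt; apply: contraL ci => lt; apply: (nbc_below nbc_S) =>
  [|x /(tailset_leq c)]; first exact: tailset_sub.
  exact: leq_trans.
- by apply: mk.
Qed.

Lemma vertex_min a k : Gamma_vertex M S a k.+1 ->
  [/\ a \in N M S, (k < ell)%N, early S a k.+1 & min_over a k].
Proof. by move=> /and4P[aN kl na ea]; split=> //; apply/vertexP. Qed.

Lemma vertexI a k : a \in N M S -> (k < ell)%N -> early S a k.+1 -> min_over a k ->
  Gamma_vertex M S a k.+1.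
Proof. by move=> aN kl ea mk; rewrite /Gamma_vertex aN ea /= kl andbT; apply/vertexP. Qed.

(** An element [c] of the smaller difference also belongs to the larger one: if [c] were in the
    closure of [D i], exchange would put [a] there. *)
Lemma min_over_mono a i j : a \in N M S -> (i <= j)%N -> min_over a i -> min_over a j.
Proof.
move=> /memN[_ _ _ _ an] ij mi c ca cn; apply: mi.
  by apply: (subsetP (mclS _ _)) ca; rewrite setUS ?tailset_subS.
apply: contra (an i) => ci; have := mcl_exchange ca cn.
apply: (subsetP (mcl_subset _)); rewrite subUset sub1set ci.
by apply: subset_trans (sub_mcl _ _); rewrite tailset_subS.
Qed.

Lemma join_tail a k : mjoin M [set a] (tail_flat M S k.+1) = cl (a |: D k).
Proof.
rewrite /mjoin /tail_flat /=; apply/eqP;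
  rewrite eqEsubset [X in _ && X]mclS ?setUS ?sub_mcl // andbT.
by rewrite mcl_subset // subUset sub1set (subsetP (sub_mcl _ _)) ?setU11 //= mclS ?subsetUr.
Qed.

Lemma edgeE a b k : Gamma_edge M S a b k.+1 =
  [&& Gamma_vertex M S a k.+1, Gamma_vertex M S b k.+2 & cl (a |: D k) == cl (b |: D k)].
Proof. by rewrite /Gamma_edge !join_tail. Qed.

(** Since [b] lies in the closure of [a |: D k], minimality of [a] gives [a < b]. Then [a] cannot
    lie in the closure of [b |: D k.+1], by minimality of [b]; so [a] belongs to the step of the
    flag of [b] whose least element is the entry of [S] at index [k]. *)
Lemma edge_lt a b k x0 : Gamma_edge M S a b k.+1 -> a != b ->
  [/\ (k.+1 < ell)%N, (nth x0 s k < a)%N & (a < b)%N].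
Proof.
rewrite edgeE => /and3P[/vertex_min[aN _ ea ma] vb /eqP eab] nab.
have [bN kl eb mb] := vertex_min vb.
have [_ _ _ _ an] := memN aN; have [_ _ _ _ bn] := memN bN.
have bin : b \in cl (a |: D k) by rewrite eab (subsetP (sub_mcl _ _)) ?setU11.
have lt_ab : (a < b)%N.
  by rewrite ltn_neqAle ma // andbT; apply: contra nab => /eqP/val_inj->.
split=> //; have sk : nth x0 s k \in D k by rewrite nth_in_tailset // ltn_predRL.
have ska : nth x0 s k != a by apply: contraNneq (an k) => <-; apply: (subsetP (sub_mcl _ _)).
rewrite ltn_neqAle ska /=.
have kU := insertion_base k.+1 bN; have /(neatP kU) nb :
  neat M (insertion S b k.+2) by move: vb => /and4P[].
have := nb k a (ltnW kl); rewrite nth_insertion // ltnSn.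
rewrite (set_nth_default x0); last by rewrite sz ltn_predRL.
apply; rewrite in_setD /step /tail !drop_insertion // leqnn leqnSn.
rewrite -eab; apply/andP; split; last by rewrite (subsetP (sub_mcl _ _)) ?setU11.
apply: contraL lt_ab => ai; rewrite -leqNgt; exact: mb.
Qed.

(** The parent is the least element [a] of the part that [b] would add to the closure of [D k]. The
    point is that [a |: S] is again nbc. The case [a = b] may occur; such an edge of [Gamma(S)]
    gives no edge of [t(S)]. *)
Lemma parent_exists b k : Gamma_vertex M S b k.+2 -> exists a, Gamma_edge M S a b k.+1.
Proof.
move=> vb; have [bN kl eb mb] := vertex_min vb.
have [bS nbS _ _ bn] := memN bN.
have kl1 : (k < ell.-1)%N by rewrite ltn_predRL.
have sk_b : (nth b s k < b)%N by apply: early_lt eb _ _.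
have skD : nth b s k \in D k by rewrite nth_in_tailset.
have bin : b \in cl (b |: D k) by rewrite (subsetP (sub_mcl _ _)) ?setU11.
have [|a ea] := @smin_neq0 _ (cl (b |: D k) :\: cl (D k)).
  by apply/set0Pn; exists b; rewrite in_setD bn bin.
have /sminP[/setDP[ab an] amin] := introT eqP ea.
have eab : cl (a |: D k) = cl (b |: D k).
  have ba := mcl_exchange ab an.
  apply/eqP; rewrite eqEsubset; apply/andP; split; apply: mcl_subset.
    by rewrite subUset sub1set ab (subset_trans (subsetUr _ _) (sub_mcl _ _)).
  by rewrite subUset sub1set ba (subset_trans (subsetUr _ _) (sub_mcl _ _)).
have sk_a : (nth b s k < a)%N.
  rewrite ltn_neqAle; apply/andP; split.
    by apply: contraNneq an => /val_inj <-; apply: (subsetP (sub_mcl _ _)).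
  rewrite leqNgt; apply: contraL ab => lt; apply: (nbc_below nbS);
    first by rewrite setUS ?tailset_sub.
  move=> x; rewrite in_setU1 => /orP[/eqP->|/(tailset_leq b)];
    [exact: ltn_trans sk_b|exact: leq_trans].
have aS : a \notin S.
  apply: contra an => aS; apply: (subsetP (sub_mcl _ _)); exact: mem_tailset kl1 aS sk_a.
have naS : a |: S \in nbc M.
  apply/nbcP => c; have [ac|ca] := leqP a c.
    have /nbcP/(_ c) := nbc_S; apply: contra; apply/subsetP/mclS/subsetP => x.
    rewrite !inE => /andP[/orP[/eqP->|-> ->] //]; by rewrite ltnNge ac.
  apply/negP => cin; have {cin} : c \in cl (a |: above S c).
    apply: (subsetP (mclS _ _)) cin; apply/subsetP => x; rewrite !inE.
    by case/andP => /orP[->|-> ->]; rewrite ?orbT.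
  have [csk|skc] := ltnP c (nth b s k).
    (* Here [above S c] contains [D k], so [a] may be replaced by [b], and [b |: S] is nbc. *)
    have sub1 : a |: above S c \subset cl (b |: above S c).
      rewrite subUset sub1set (subset_trans _ (sub_mcl _ _)) ?subsetUr // andbT.
      apply: (subsetP (mclS _ _)) ab; rewrite setUS //; apply/subsetP => x xD.
      by rewrite inE (subsetP (tailset_sub k)) //=; apply: leq_trans csk (tailset_leq _ xD).
    move=> /(subsetP (mcl_subset sub1)); apply/negP; apply: (nbc_below nbS).
      by rewrite setUS //; apply/subsetP => x; rewrite inE => /andP[].
    move=> x; rewrite in_setU1 => /orP[/eqP->|]; first exact: ltn_trans csk sk_b.
    by rewrite inE => /andP[].
  (* Otherwise [above S c] lies in [D k], so [c < a] lies in the closure of [b |: D k]. It competes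
     with the minimum [a] unless it lies in the closure of [D k], in which case exchange puts [a]
     there. *)
  move=> cin; have sDc : above S c \subset D k.
    apply/subsetP => x; rewrite [x \in above _ _]inE => /andP[xS cx].
    exact: mem_tailset kl1 xS (leq_ltn_trans skc cx).
  have cS : c \notin cl (above S c) by have /nbcP := nbc_S; apply.
  have aex := mcl_exchange cin cS.
  have cb : c \in cl (b |: D k).
    by rewrite -eab; apply: (subsetP (mclS _ _)) cin; rewrite setUS.
  have [cD|cD] := boolP (c \in cl (D k)).
    case/negP: an; apply: (subsetP (mcl_subset _)) aex.
    by rewrite subUset sub1set cD (subset_trans sDc) ?sub_mcl.
  by move: ca; rewrite ltnNge amin // in_setD cD.
have aN : a \in N M S.
  have [_ _ _ l0 _] := memN bN.
  by rewrite inE aS /= inE naS cardsU1 aS cardE sz add1n prednK /=.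
exists a; rewrite edgeE; apply/and3P; split; [|exact: vb|exact/eqP].
apply: vertexI => //; first exact: ltnW.
  rewrite /early /=; case: (posnP k) => [->//|k0]; apply/orP; right.
  apply: leq_ltn_trans sk_a; rewrite (set_nth_default b) ?sz ?nth_enum_leq ?leq_pred //;
    exact: leq_ltn_trans (leq_pred k) kl1.
by move=> c ca cn; apply: amin; rewrite in_setD cn -eab.
Qed.

(** Take for [k] the place of [a] in increasing order; the insertion then enumerates the nbc base
    [a |: S] and is neat. *)
Lemma vertex_top a : a \in N M S -> exists k, Gamma_vertex M S a k.+1.
Proof.
move=> aN; have [aS naS _ l0 an] := memN aN.
exists (find (fun x : 'I_n => a < x)%N s); set k := find _ _.
have kl : (k < ell)%N by have := find_size (fun x : 'I_n => a < x)%N s; rewrite sz -/k -ltnS prednK.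
have ea : early S a k.+1.
  rewrite /early /=; case: (posnP k) => [->//|k0]; apply/orP; right.
  have := @before_find _ a (fun x : 'I_n => a < x)%N s k.-1; rewrite -/k prednK // leqnn.
  move=> /(_ isT)/negbT; rewrite -leqNgt leq_eqVlt => /orP[/eqP/val_inj e|//].
  by move: aS; rewrite -e -mem_enum mem_nth // sz ltn_predRL prednK.
apply: vertexI => // c ca _; rewrite leqNgt; apply: contraL ca => lt.
apply: (nbc_below naS); first by rewrite setUS ?tailset_sub.
move=> x; rewrite in_setU1 => /orP[/eqP->//|xD]; apply: leq_trans (tailset_leq a xD).
apply: (leq_trans lt); apply: ltnW; apply: (@nth_find _ a (fun x : 'I_n => a < x)%N s);
  rewrite has_find -/k.
by move: xD; rewrite inE ltnNge; apply: contraTN => /drop_oversize->.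
Qed.

(** At equal levels [a] and [a'] are minima of the same difference of flats. If the second edge is
    at a higher level, [b] is already minimal over [D k'], where [a'] competes with it, which
    contradicts [a' < b]. *)
Lemma edge_unique a a' b k k' : Gamma_edge M S a b k.+1 -> Gamma_edge M S a' b k'.+1 ->
  a != b -> a' != b -> a = a'.
Proof.
wlog le_kk' : a a' k k' / (k <= k')%N.
  move=> H e e' n1 n2; have [le|/ltnW le] := leqP k k'; first exact: (H a a' k k').
  by symmetry; apply: (H a' a k' k).
move=> e e' nab na'b; have [_ _ lt'] := edge_lt b e' na'b.
move: e e'; rewrite !edgeE.
move=> /and3P[/vertex_min[aN _ _ ma] /vertex_min[bN _ _ mb] /eqP eab].
move=> /and3P[/vertex_min[a'N _ _ ma'] _ /eqP ea'b].
have [_ _ _ _ an] := memN aN; have [_ _ _ _ a'n] := memN a'N.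
have in_self x k0 : x \in cl (x |: D k0) by rewrite (subsetP (sub_mcl _ _)) ?setU11.
case: ltngtP le_kk' => // [lt|ekk] _.
  have mb' := min_over_mono bN lt mb.
  by move: lt'; rewrite ltnNge mb' // -ea'b.
rewrite -ekk in ma' ea'b; apply/val_inj/eqP; rewrite eqn_leq ma ?ma' //.
  by rewrite ea'b -eab.
by rewrite eab -ea'b.
Qed.

(* A vertex [S(b, k+1)] all of whose ancestors come from [b] itself leads down to level 1,
   which has a unique vertex. *)
Lemma root_unique a b : a \in N M S -> b \in N M S ->
  (forall c k, Gamma_edge M S c a k.+1 -> c = a) ->
  (forall c k, Gamma_edge M S c b k.+1 -> c = b) -> a = b.
Proof.
have down x : x \in N M S -> (forall c k, Gamma_edge M S c x k.+1 -> c = x) -> min_over x 0.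
  move=> xN rx; have [k] := vertex_top xN; elim: k => [|k IHk] vx.
    by have [] := vertex_min vx.
  have [c ec] := parent_exists vx; apply: IHk.
  by move: (ec); rewrite edgeE (rx _ _ ec) => /and3P[].
move=> aN bN /(down _ aN) ma /(down _ bN) mb.
have full x : x \in N M S -> cl (x |: D 0) = setT.
  move=> xN; have [xS nxS nxS' l0 _] := memN xN; rewrite drop0 set_enum.
  by apply: mcl_base; [exact: nbc_indep | move: nxS'; rewrite inE => /andP[_ /eqP]].
have [_ _ _ _ an] := memN aN; have [_ _ _ _ bn] := memN bN.
by apply/val_inj/eqP; rewrite eqn_leq; apply/andP; split; [apply: ma | apply: mb];
  rewrite // full // in_setT.
Qed.


End Graph.

(** * The relations and their leading coordinates *)

Section TriangularBasis.
Variables (R : comNzRingType) (V : lmodType R) (I G : finType).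
Variables (W : V -> Prop) (r : G -> V) (cd : V -> I -> R) (lead : G -> I) (w : I -> nat).
Hypothesis cd_lin : forall k u v i, cd (k *: u + v) i = k * cd u i + cd v i.
Hypothesis rW : forall g, W (r g).
Hypothesis W_lin : forall k u v, W u -> W v -> W (k *: u + v).
Hypothesis cd_lead : forall g, cd (r g) (lead g) * cd (r g) (lead g) = 1.
Hypothesis cd_above : forall g i, cd (r g) i != 0 -> i = lead g \/ (w (lead g) < w i)%N.
Hypothesis lead_inj : injective lead.
Hypothesis W_eq0 : forall v, W v -> (forall g, cd v (lead g) = 0) -> v = 0.

Lemma cd0 i : cd 0 i = 0.
Proof. by have := cd_lin 1 0 0 i; rewrite scaler0 add0r mul1r => /eqP;
  rewrite eq_sym -subr_eq0 addrK => /eqP. Qed.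

Lemma cd_sum (P : pred G) (c : G -> R) i :
  cd (\sum_(g | P g) c g *: r g) i = \sum_(g | P g) c g * cd (r g) i.
Proof.
elim/big_rec2: _ => [|g x v _ <-]; first exact: cd0.
exact: cd_lin.
Qed.

Lemma W_sub_sum (P : pred G) (c : G -> R) v : W v -> W (v - \sum_(g | P g) c g *: r g).
Proof.
move=> Wv; rewrite -sumrN; elim/big_rec: _ => [|g x _ Wx]; first by rewrite addr0.
by rewrite addrCA -scaleNr; apply: W_lin.
Qed.

Lemma cd_sub_sum (P : pred G) (c : G -> R) v i :
  cd (v - \sum_(g | P g) c g *: r g) i = cd v i - \sum_(g | P g) c g * cd (r g) i.
Proof. by rewrite addrC -scaleN1r cd_lin cd_sum mulN1r addrC. Qed.

(** At [lead g] only [r g] and elements of smaller leading weight can be nonzero. Induction on the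
    weight thus gives independence, and clearing leading coordinates by increasing weight reduces
    any member of [W] to the case of [W_eq0]. *)
Lemma triangular_is_basis : is_basis W r.
Proof.
split=> // [c cr|v Wv].
  suff H k g : (w (lead g) < k)%N -> c g = 0 by move=> g; apply: (H (w (lead g)).+1).
  elim: k g => // k IHk g; rewrite ltnS => le.
  have := cd_sum xpredT c (lead g); rewrite cr cd0 (bigD1 g) //= big1 ?addr0 => [|g' ng].
    move/(congr1 (fun x => x * cd (r g) (lead g))).
    by rewrite mul0r -mulrA cd_lead mulr1 => <-.
  have [->|/cd_above[/lead_inj e|lt]] := eqVneq (cd (r g') (lead g)) 0; first by rewrite mulr0.
    by rewrite e eqxx in ng.
  by rewrite IHk ?mul0r //; apply: leq_trans lt le.
have H k : exists c : G -> R, forall g, (w (lead g) < k)%N ->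
    cd (v - \sum_g c g *: r g) (lead g) = 0.
  elim: k => [|k [c hc]]; first by exists (fun=> 0).
  set v' := v - _ in hc.
  (* All leading coordinates of weight [k] are cleared at once: the correction does not touch those
     of smaller weight, and distinct leads of equal weight do not interact. *)
  pose d g := if w (lead g) == k then cd v' (lead g) * cd (r g) (lead g) else 0.
  exists (fun g => c g + d g) => g; rewrite ltnS => le.
  have -> : v - \sum_g (c g + d g) *: r g = v' - \sum_g d g *: r g.
    by rewrite /v' -addrA -opprD -big_split /=; under eq_bigr do rewrite scalerDl.
  rewrite cd_sub_sum (bigD1 g) //= [X in _ - (_ + X)]big1 ?addr0 => [|g' ng].
    rewrite /d; move: le; rewrite leq_eqVlt => /orP[->|lt].
      by rewrite -mulrA cd_lead mulr1 subrr.
    by rewrite (ltn_eqF lt) hc // mul0r subr0.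
  rewrite /d; case: eqP => [ek|_]; last by rewrite mul0r.
  have [->|/cd_above[/lead_inj e|]] := eqVneq (cd (r g') (lead g)) 0; first by rewrite mulr0.
    by rewrite e eqxx in ng.
  by rewrite ek ltnNge le.
have [c hc] := H (\max_g w (lead g)).+1; exists c.
apply/eqP; rewrite -subr_eq0; apply/eqP/W_eq0 => [|g]; first exact: W_sub_sum.
by apply: hc; rewrite ltnS leq_bigmax.
Qed.

End TriangularBasis.

Lemma subn_neq l k p : (p <= l)%N -> p != (l - k)%N -> (k <= l)%N -> (l - p)%N != k.
Proof. by move=> *; lia. Qed.

Lemma iota_split l k : (k.+1 < l)%N -> let m := (l - k.+1)%N in
  iota 1 l = iota 1 m.-1 ++ m :: m.+1 :: iota m.+2 (l - m.+1).
Proof.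
move=> kl m; rewrite {1}(_ : l = m.-1 + (l - m.+1).+2)%N ?iotaD; last by rewrite /m; lia.
by have -> : (1 + m.-1)%N = m by rewrite /m; lia.
Qed.

Lemma mem_iota_lo m p : p \in iota 1 m.-1 -> [/\ (p <= m)%N, p != m & p.-1 != m].
Proof. by rewrite mem_iota => h; split; lia. Qed.

Lemma mem_iota_hi l k p : (k.+1 < l)%N -> let m := (l - k.+1)%N in
  p \in iota m.+2 (l - m.+1) -> [/\ (p <= l)%N, p != m & p.-1 != m].
Proof. by move=> kl m; rewrite mem_iota /m => h; split; lia. Qed.

Lemma lincomb_mul (R : comNzRingType) (A : algType R) (J : finType) (c c' : J -> R) (e : R)
    (g g' : A) (v : J -> A) :
  \sum_j (c j *: g - e *: (c' j *: g')) * v j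
  = g * (\sum_j c j *: v j) - e *: (g' * (\sum_j c' j *: v j)).
Proof.
rewrite !mulr_sumr scaler_sumr -sumrB; apply: eq_bigr => j _.
by rewrite mulrBl -!scalerAl -!scalerAr.
Qed.

Section Relations.
Variables (R : comNzRingType) (n : nat) (M : matroid n) (M_simple : simple_matroid M).
Local Notation E := (exterior R n).
Local Notation gen := (ext_gen R).
Local Notation basis := (ext_basis R).
Local Notation cl := (mcl M).
Local Notation ell := (mrank M).
Local Notation nbcb := (nbc_base M).
Local Notation zU U := (z R M (flag_of M U)).
Implicit Types (A B S X Y : {set 'I_n}) (U : seq 'I_n) (a b c x y : 'I_n) (T : nbcb).

Definition relcoord (v : {ffun nbcb -> E}) (i : nbcb * 'I_n) : R := v i.1 [set i.2].
(** The lexicographic order on the pair [(\sum T - j, - j)], with [- j] shifted to [n - j] to stay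
    in [nat] and the pair written in base [n.+1]. *)
Definition relweight (i : nbcb * 'I_n) : nat :=
  ((\sum_(x in val i.1) x + (n - i.2)) * n.+1 + (n - i.2))%N.

Lemma family_linE k (u v : {ffun nbcb -> E}) T : (k *: u + v) T = k *: u T + v T.
Proof. by rewrite [LHS]ffunE [X in X + _]ffunE. Qed.

Lemma relcoord_lin k (u v : {ffun nbcb -> E}) (i : nbcb * 'I_n) :
  relcoord (k *: u + v) i = k * relcoord u i + relcoord v i.
Proof. by rewrite /relcoord family_linE ext_addE ext_scaleE. Qed.

Lemma is_relation_lin k (u v : {ffun nbcb -> E}) :
  is_relation u -> is_relation v -> is_relation (k *: u + v).
Proof.
move=> [hu ru] [hv rv]; split=> [T A|].
  rewrite family_linE ext_addE ext_scaleE; have [->|/hu//] := eqVneq (u T A) 0.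
  by rewrite mulr0 add0r => /hv.
under eq_bigr do rewrite family_linE mulrDl -scalerAl.
by rewrite big_split /= -scaler_sumr ru rv scaler0 addr0.
Qed.

Lemma gen1E x (j : 'I_n) : gen x [set j] = (j == x)%:R.
Proof. by rewrite ext_gen_basis ext_basisE (inj_eq set1_inj). Qed.

Lemma ext_homog_gen x : ext_homog 1 (gen x).
Proof. by rewrite -(cards1 x); apply: ext_homog_basis. Qed.

Lemma ext_homog_lin p k (a b : E) : ext_homog p a -> ext_homog p b -> ext_homog p (k *: a + b).
Proof.
move=> ha hb A; rewrite ext_addE ext_scaleE; have [->|/ha//] := eqVneq (a A) 0.
by rewrite mulr0 add0r => /hb.
Qed.

Lemma ext_homog_scale p k (a : E) : ext_homog p a -> ext_homog p (k *: a).
Proof. by move=> ha A; rewrite ext_scaleE; have [->|/ha//] := eqVneq (a A) 0;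
  rewrite mulr0 eqxx. Qed.

Lemma ext_homog_genB x y : ext_homog 1 (gen x - gen y).
Proof. by rewrite addrC -scaleN1r; apply: ext_homog_lin; apply: ext_homog_gen. Qed.

Lemma gen_min_step x0 U i : ordered_base M U -> min_steps M U -> (i < ell)%N ->
  gen_min R (step M U i) = gen (nth x0 U i).
Proof. by move=> bU mU il; rewrite /gen_min (smin_step bU x0 mU il). Qed.

Lemma setD_chain (X0 X1 X2 : {set 'I_n}) : X2 \subset X1 -> X1 \subset X0 ->
  (X1 :\: X2) :|: (X0 :\: X1) = X0 :\: X2.
Proof.
move=> s21 s10; apply/setP => x; rewrite !inE.
have /implyP := subsetP s21 x; have /implyP := subsetP s10 x.
by case: (x \in X0); case: (x \in X1); case: (x \in X2).
Qed.

Lemma find_iota (p : pred nat) m N : (m < N)%N -> p m -> (forall i, (i < m)%N -> ~~ p i) ->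
  find p (iota 0 N) = m.
Proof.
move=> mN pm lt_m; have [lt|lt|//] := ltngtP (find p (iota 0 N)) m.
  have h : has p (iota 0 N) by rewrite has_find size_iota (ltn_trans lt).
  have := nth_find 0%N h; rewrite nth_iota ?(ltn_trans lt) //.
  by rewrite add0n (negbTE (lt_m _ lt)).
by have := before_find 0%N lt; rewrite nth_iota // add0n pm.
Qed.

(** * Two neat ordered bases whose flags differ only in rank [m = ell - k.+1] *)

Section ClosePair.
Variables (U U' : seq 'I_n) (x y x' y' : 'I_n) (k m : nat).
Hypotheses (kl : (k.+1 < ell)%N) (mE : m = (ell - k.+1)%N) (bU : ordered_base M U) (bU' :
  ordered_base M U').
Hypotheses (mU : min_steps M U) (mU' : min_steps M U').
Hypothesis tail_eq : forall i, i != k.+1 -> tail M U i = tail M U' i.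
Hypothesis tail_neq : tail M U k.+1 != tail M U' k.+1.
Hypotheses (xE : nth x U k.+1 = x) (yE : nth x U k = y).
Hypotheses (xE' : nth x U' k.+1 = x') (yE' : nth x U' k = y').
Local Notation F := (flag_of M U).
Local Notation F' := (flag_of M U').

Lemma close_flag_eq p : (p <= ell)%N -> p != m -> F p = F' p.
Proof.
rewrite mE => pl npm; rewrite (flag_of_tail bU) (flag_of_tail bU') tail_eq //.
by apply: subn_neq => //; apply: ltnW.
Qed.

Lemma subn_m : (ell - m)%N = k.+1.
Proof. by rewrite mE subKn // ltnW. Qed.

Lemma close_diff_rank : diff_rank M F F' = m.
Proof.
apply: find_iota => [||i im]; first by rewrite mE ltnS leq_subr.
  by rewrite (flag_of_tail bU) (flag_of_tail bU') subn_m.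
rewrite negbK; apply/eqP/close_flag_eq; last by rewrite ltn_eqF.
by rewrite (leq_trans (ltnW im)) // mE leq_subr.
Qed.

Lemma part_m V : ordered_base M V -> part (flag_of M V) m = step M V k.+1.
Proof. by move=> bV; rewrite mE part_step. Qed.

Lemma part_m1 V : ordered_base M V -> part (flag_of M V) m.+1 = step M V k.
Proof. by move=> bV; rewrite mE subnSK ?part_step // ltnW. Qed.

Lemma close_relE T : close_rel R M F F' T =
  zcoord M (zU U) T *: (gen x - gen y)
  - (-1) ^+ (#|F m| + #|F' m|) *: (zcoord M (zU U') T *: (gen x' - gen y')).
Proof.
rewrite /close_rel close_diff_rank ffunE (part_m bU) (part_m bU') (part_m1 bU) (part_m1 bU').
rewrite (gen_min_step x bU mU kl) (gen_min_step x bU mU (ltnW kl)).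
by rewrite (gen_min_step x bU' mU' kl) (gen_min_step x bU' mU' (ltnW kl)) xE yE xE' yE'.
Qed.

Lemma relcoord_close T j : relcoord (close_rel R M F F') (T, j) =
  zcoord M (zU U) T * ((j == x)%:R - (j == y)%:R)
  - (-1) ^+ (#|F m| + #|F' m|) * (zcoord M (zU U') T * ((j == x')%:R - (j == y')%:R)).
Proof.
by rewrite /relcoord close_relE /= !(ext_addE, ext_oppE, ext_scaleE) !gen1E.
Qed.

Lemma card_tail V i : ordered_base M V -> #|tail M V i| = (#|step M V i| + #|tail M V i.+1|)%N.
Proof.
move=> bV; rewrite tail_split // cardsU (_ : _ :&: _ = set0) ?cards0 ?subn0 //.
by apply/eqP; rewrite setI_eq0 disjoint_sym disjoint_setD.
Qed.

Lemma steps_split V : ordered_base M V ->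
  steps M V = [seq part (flag_of M V) p | p <- iota 1 m.-1] ++ step M V k.+1 :: step M V k
    :: [seq part (flag_of M V) p | p <- iota m.+2 (ell - m.+1)].
Proof.
by move=> bV; rewrite -(part_m bV) -(part_m1 bV) /steps mE {1}(iota_split kl) map_cat.
Qed.

Lemma close_part_eq p : (p <= ell)%N -> p != m -> p.-1 != m -> part F' p = part F p.
Proof.
move=> pl pm pm1; rewrite /part (close_flag_eq pl pm) (close_flag_eq _ pm1) //.
exact: leq_trans (leq_pred p) pl.
Qed.

Lemma close_is_relation : is_relation (close_rel R M F F').
Proof.
split=> [T|].
  rewrite close_relE addrC -scaleN1r; apply: ext_homog_lin;
    by do ?apply: ext_homog_scale; apply: ext_homog_genB.
under eq_bigr do rewrite close_relE.
rewrite lincomb_mul -(zcoordP R M_simple bU) -(zcoordP R M_simple bU').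
apply/eqP; rewrite subr_eq0; apply/eqP.
have e1 := steps_split bU; have e2 := steps_split bU'.
have es1 : [seq part F' p | p <- iota 1 m.-1] = [seq part F p | p <- iota 1 m.-1].
  apply/eq_in_map => p /mem_iota_lo; case=> h1 h2 h3; apply: close_part_eq => //.
  by rewrite (leq_trans h1) // mE leq_subr.
have es2 : [seq part F' p | p <- iota m.+2 (ell - m.+1)]
    = [seq part F p | p <- iota m.+2 (ell - m.+1)].
  apply/eq_in_map => p; rewrite mE => /(mem_iota_hi kl); rewrite -mE.
  by case=> h1 h2 h3; apply: close_part_eq.
rewrite es1 es2 in e2.
rewrite (@z_close R _ _ M_simple U U' x y x' y' _ _ _ _ _ _ bU bU' e1 e2).
(* The flats of rank [m] have a common subflat of rank [m - 1], whose cardinality enters the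
   exponent twice and cancels. *)
- congr (_ *: _); rewrite (flag_of_tail bU) (flag_of_tail bU') subn_m.
  rewrite (card_tail _ bU) (card_tail _ bU') -(tail_eq (i := k.+2)) ?gtn_eqF // !exprD.
  by rewrite mulrACA ext_sqr_sign mulr1.
- rewrite (setD_chain (tail_sub _ _ (leqnSn _)) (tail_sub _ _ (leqnSn _))).
  rewrite (setD_chain (tail_sub _ _ (leqnSn _)) (tail_sub _ _ (leqnSn _))).
  by rewrite (tail_eq (i := k)) ?ltn_eqF // (tail_eq (i := k.+2)) ?gtn_eqF.
- by rewrite -xE; apply: mem_step.
- by rewrite -yE; apply: mem_step => //; apply: ltnW.
- by rewrite -xE'; apply: mem_step.
- by rewrite -yE'; apply: mem_step => //; apply: ltnW.
Qed.

End ClosePair.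

End Relations.

Lemma ltn_lexi (n A B x y : nat) : (x <= n)%N ->
  (A < B)%N || (A <= B)%N && (x < y)%N -> (A * n.+1 + x < B * n.+1 + y)%N.
Proof.
move=> xn /orP[lt|/andP[le lt]].
  have : (A.+1 * n.+1 <= B * n.+1)%N by rewrite leq_mul2r lt orbT.
  by rewrite mulSn; lia.
have : (A * n.+1 <= B * n.+1)%N by rewrite leq_mul2r le orbT.
lia.
Qed.

(** Here [s < a < b] are the generators in an edge relation, [SS] and [TT] the sums of [S] and [T].
    The clauses compare the lead [(S + b, b)] with [(T, s)] and [(T, a)] from the first flag and
    with [(T, s)] from the second. *)
Lemma weight_arith (n a b s SS TT : nat) : (s < a)%N -> (a < b)%N -> (b < n)%N ->
  [/\ (SS + a <= TT)%N -> (SS + b + (n - b) < TT + (n - s))%N,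
      (SS + a <= TT)%N -> (SS + b + (n - b) <= TT + (n - a))%N && (n - b < n - a)%N
    & (SS + b <= TT)%N -> (SS + b + (n - b) < TT + (n - s))%N].
Proof. by move=> *; split=> *; lia. Qed.

Lemma unit_coord_sqr (R : comNzRingType) (q q' : R) e j : q' = (-1) ^+ j ->
  let c := q * (false%:R - false%:R) - (-1) ^+ e * (q' * (true%:R - false%:R)) in c * c = 1.
Proof.
move=> -> /=; rewrite !subr0 mulr0 mulr1 sub0r mulrNN mulrACA.
by rewrite !ext_sqr_sign mulr1.
Qed.

Section Relations.
Variables (R : comNzRingType) (n : nat) (M : matroid n) (M_simple : simple_matroid M).
Local Notation E := (exterior R n).
Local Notation gen := (ext_gen R).
Local Notation basis := (ext_basis R).
Local Notation cl := (mcl M).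
Local Notation ell := (mrank M).
Local Notation nbcb := (nbc_base M).
Local Notation zU U := (z R M (flag_of M U)).
Implicit Types (A B S X Y : {set 'I_n}) (U : seq 'I_n) (a b c x y : 'I_n) (T : nbcb).

Lemma relweight_lt (i i' : nbcb * 'I_n) :
  let s (i : nbcb * 'I_n) := (\sum_(x in val i.1) x + (n - i.2))%N in
  (s i < s i')%N || (s i <= s i')%N && (n - i.2 < n - i'.2)%N -> (relweight i < relweight i')%N.
Proof. by move=> s h; apply: ltn_lexi h; apply: leq_subr. Qed.

Lemma set_insertion S x k : [set y in insertion S x k.+1] = x |: S.
Proof.
apply/setP => y; rewrite !inE mem_cat inE orbCA -mem_cat cat_take_drop.
by rewrite mem_enum.
Qed.

Lemma sum_setU1 S x : x \notin S -> (\sum_(y in x |: S) y = \sum_(y in S) y + x)%N.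
Proof. by move=> xS; rewrite big_setU1 //= addnC. Qed.

Lemma zcoord_sum S x k T : S \in nbc_of_size M ell.-1 -> x \in N M S ->
  min_steps M (insertion S x k.+1) ->
  zcoord M (zU (insertion S x k.+1)) T != 0 ->
  (\sum_(y in S) y + x <= \sum_(y in val T) y)%N /\
  ((\sum_(y in S) y + x = \sum_(y in val T) y)%N -> val T = x |: S).
Proof.
move=> nS xN mx nz; have bx := insertion_base nS k xN.
have := transversal_sum M_simple bx mx (zcoord_neq0 M_simple bx nz).
have -> : (\sum_(y in insertion S x k.+1) y = \sum_(y in S) y + x)%N.
  have [xS _ _ _ _] := memN xN.
  by rewrite -(sum_setU1 xS) -(set_insertion S x k); apply: eq_bigl => y; rewrite inE.
by rewrite set_insertion.
Qed.

(** * The relation attached to an edge of [t(S)] *)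

Section Edge.
Variables (S : {set 'I_n}) (a b : 'I_n) (k : nat).
Hypotheses (nS : S \in nbc_of_size M ell.-1) (eab : Gamma_edge M S a b k.+1) (nab : a != b).

Lemma edge_props : [/\ a \in N M S, b \in N M S,
  min_steps M (insertion S a k.+1) & min_steps M (insertion S b k.+2)].
Proof.
move: eab => /and3P[/and4P[aN _ na _] /and4P[bN _ nb _] _]; split=> //.
  by apply/neatP => //; apply: insertion_base.
by apply/neatP => //; apply: insertion_base.
Qed.

(** Up to index [k] both tails contain the common flat spanned by [D k] with [a] or with [b]; beyond
    [k.+1] the inserted element has been dropped. *)
Lemma edge_tail_eq i : i != k.+1 ->
  tail M (insertion S a k.+1) i = tail M (insertion S b k.+2) i.
Proof.
have [kl _ _] := edge_lt nS a eab nab.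
move=> nik; rewrite /tail (drop_insertion nS _ _ (ltnW kl)) (drop_insertion nS _ _ kl).
have [ik|ki] := leqP i k; last by rewrite ifN // -ltnNge ltn_neqAle eq_sym nik.
rewrite leqW //; have := eab; rewrite edgeE => /and3P[_ _ /eqP e].
have up x : cl (x |: [set y in drop i (enum S)]) =
    cl (cl (x |: [set y in drop k (enum S)]) :|: [set y in drop i (enum S)]).
  apply/eqP; rewrite eqEsubset; apply/andP; split; apply: mcl_subset; rewrite subUset.
    rewrite sub1set (subset_trans (subsetUr _ _) (sub_mcl _ _)) andbT.
    apply: (subsetP (sub_mcl _ _)); rewrite in_setU; apply/orP; left.
    by apply: (subsetP (sub_mcl _ _)); rewrite setU11.
  rewrite (subset_trans (subsetUr _ _) (sub_mcl _ _)) andbT.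
  by apply: mclS; rewrite setUS ?tailset_subS.
by rewrite up e -up.
Qed.

Lemma edge_tail_neq : tail M (insertion S a k.+1) k.+1 != tail M (insertion S b k.+2) k.+1.
Proof.
have [kl _ _] := edge_lt nS a eab nab; have [aN bN _ _] := edge_props.
rewrite /tail (drop_insertion nS _ _ (ltnW kl)) (drop_insertion nS _ _ kl) ltnn leqnn /=.
have [_ _ _ _ bn] := memN bN.
by apply: contraNneq (bn k) => ->; apply: (subsetP (sub_mcl _ _)); rewrite setU11.
Qed.

Let v := close_rel R M (flag_of M (insertion S a k.+1)) (flag_of M (insertion S b k.+2)).

(** Writing [s] for the entry of [S] at index [k], the first flag has [alpha = s], [beta = a] and
    the second [alpha' = b], [beta' = s]. The exponent stays existential, since only the fact that
    it yields a sign matters later. *)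
Lemma edge_relation : is_relation v /\
  (forall T j, exists e, relcoord v (T, j) =
    zcoord M (zU (insertion S a k.+1)) T * ((j == nth a (enum S) k)%:R - (j == a)%:R)
    - (-1) ^+ e * (zcoord M (zU (insertion S b k.+2)) T
        * ((j == b)%:R - (j == nth a (enum S) k)%:R))).
Proof.
have [kl _ _] := edge_lt nS a eab nab; have [aN bN ma mb] := edge_props.
have bU := insertion_base nS k aN; have bU' := insertion_base nS k.+1 bN.
have e0 : nth (nth a (enum S) k) (enum S) k = nth a (enum S) k.
  apply: set_nth_default; move: nS; rewrite inE -cardE => /andP[_ /eqP->].
  by rewrite ltn_predRL.
have e1 : nth (nth a (enum S) k) (insertion S a k.+1) k.+1 = nth a (enum S) k.
  by rewrite (nth_insertion nS _ _ _ (ltnW kl)) ltnNge leqnSn /= gtn_eqF.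
have e2 : nth (nth a (enum S) k) (insertion S a k.+1) k = a.
  by rewrite (nth_insertion nS _ _ _ (ltnW kl)) ltnn eqxx.
have e3 : nth (nth a (enum S) k) (insertion S b k.+2) k.+1 = b.
  by rewrite (nth_insertion nS _ _ _ kl) ltnn eqxx.
have e4 : nth (nth a (enum S) k) (insertion S b k.+2) k = nth a (enum S) k.
  by rewrite (nth_insertion nS _ _ _ kl) ltnSn.
split.
  exact: (close_is_relation R M_simple kl erefl bU bU' ma mb edge_tail_eq edge_tail_neq e1 e2 e3 e4).
move=> T j; eexists; rewrite /v.
exact: (relcoord_close R kl erefl bU bU' ma mb edge_tail_eq edge_tail_neq e1 e2 e3 e4).
Qed.

Lemma edge_lead T : val T = b |: S -> relcoord v (T, b) * relcoord v (T, b) = 1.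
Proof.
move=> eT; have [kl sa ab] := edge_lt nS a eab nab; have [aN bN ma mb] := edge_props.
have [_ /(_ T b)[e ->]] := edge_relation.
have bU' := insertion_base nS k.+1 bN.
have -> : (b == a) = false by rewrite eq_sym (negbTE nab).
have -> : (b == nth a (enum S) k) = false.
  by apply/eqP => eb; move: (ltn_trans sa ab); rewrite -eb ltnn.
(* The first flag contributes nothing at [b], which is neither of its two generators; the
   coefficient is the sign of the coordinate of the second flag at its own base. *)
have [|j ej] := zcoord_unit R M_simple (T := T) bU'.
  by rewrite eT -(set_insertion S b k.+1); apply: transversal_self.
by rewrite eqxx; apply: unit_coord_sqr ej.
Qed.

Lemma edge_above T0 i : val T0 = b |: S -> relcoord v i != 0 ->
  i = (T0, b) \/ (relweight (T0, b) < relweight i)%N.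
Proof.
case: i => T j eT0; have [kl sa ab] := edge_lt nS a eab nab.
have [aN bN ma mb] := edge_props; have [bS _ _ _ _] := memN bN.
have [_ /(_ T j)[e ->]] := edge_relation; set x := nth a (enum S) k in sa *.
have [w1 w2 w3] := weight_arith (\sum_(y in S) y) (\sum_(y in val T) y) sa ab (ltn_ord b).
have e0 : (\sum_(y in val T0) y = \sum_(y in S) y + b)%N by rewrite eT0 sum_setU1.
have two (u u' : R) (f f' : R) : u * f - (-1) ^+ e * (u' * f') != 0 ->
    (u != 0) && (f != 0) \/ (u' != 0) && (f' != 0).
  move=> h; have [uf|uf] := eqVneq (u * f) 0; [right|left]; apply/andP; split.
  - by apply: contra_neq h => ->; rewrite uf mul0r mulr0 subrr.
  - by apply: contra_neq h => ->; rewrite uf !mulr0 subrr.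
  - by apply: contra_neq uf => ->; rewrite mul0r.
  - by apply: contra_neq uf => ->; rewrite mulr0.
have two_idx y y' : (j == y)%:R - (j == y')%:R != 0 :> R -> j = y \/ j = y'.
  have [->|ny] := eqVneq j y; first by left.
  by have [->|ny'] := eqVneq j y'; [right | rewrite subrr eqxx].
case/two => /andP[nz /two_idx jE].
  have [le _] := zcoord_sum nS aN ma nz; right; apply: relweight_lt; rewrite /= e0.
  by case: jE => ->; rewrite ?w1 // w2 // orbT.
have [le eq_T] := zcoord_sum nS bN mb nz.
case: jE => ->; last by right; apply: relweight_lt; rewrite /= e0 w3.
move: le; rewrite leq_eqVlt => /orP[/eqP/eq_T eT|lt].
  by left; congr pair; apply: val_inj; rewrite eT eT0.
by right; apply: relweight_lt; rewrite /= e0 ltn_add2r lt.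
Qed.

End Edge.
End Relations.

(** * Leading coordinates of all relations, and vanishing away from them *)

Section Main.
Variables (R : comNzRingType) (n : nat) (M : matroid n) (M_simple : simple_matroid M).
Local Notation E := (exterior R n).
Local Notation gen := (ext_gen R).
Local Notation ell := (mrank M).
Local Notation nbcb := (nbc_base M).
Implicit Types (A B S X Y : {set 'I_n}) (U : seq 'I_n) (a b c x y : 'I_n) (T : nbcb).

(** Both [e_x d(e_A)] and [e_y d(e_A)] equal [e_A]. *)
Lemma ext_gen_der_prod s A x y : A \in s -> x \in A -> y \in A ->
  gen x * ext_der_prod R s = gen y * ext_der_prod R s.
Proof.
case/splitPr => s1 s2 xA yA; have [p hp] := ext_der_prod_homog R s1.
rewrite ext_der_prod_cat ext_der_prod_cons !mulrA !(ext_gen_comm _ hp) -!scalerAl.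
by rewrite -!mulrA ![_ * (_ * ext_der_prod R s2)]mulrA !ext_gen_der_basis.
Qed.

Lemma gen_z_base T A x y : A \in steps M (enum (val T)) -> x \in A -> y \in A ->
  gen x * z_base R T = gen y * z_base R T.
Proof.
move=> As xA yA; rewrite /z_base /flag_of_base z_steps -!scalerAr.
by rewrite (ext_gen_der_prod As xA yA).
Qed.

(** [T] meets each part of its own flag only in the minimum [t] of that part, so [x] lies outside
    [T]. *)
Lemma part_indexP T A x : A \in parts M (flag_of_base T) -> x \in A -> Some x != smin A ->
  exists t, [/\ [/\ t \in val T, x \notin val T & (t < x)%N], gen_min R A = gen t,
    A \in steps M (enum (val T)) & t \in A].
Proof.
have bT := nbc_ordered_base (nbc_baseP T); have mT := nbc_min_steps (nbc_baseP T).
case/imsetP => p _ eA xA xmin.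
have il : (ell - p.+1 < ell)%N by rewrite ltn_subrL; apply: leq_ltn_trans (ltn_ord p).
have {}eA : A = step M (enum (val T)) (ell - p.+1).
  by rewrite eA -(part_step bT il) subKn // ltn_ord.
set i := (ell - p.+1)%N in il eA.
have mA : smin A = Some (nth x (enum (val T)) i) by rewrite eA (smin_step bT x mT il).
have /sminP[tA tmin] := introT eqP mA.
exists (nth x (enum (val T)) i); set t := nth x _ i in mA tA tmin *.
have tT : t \in val T by rewrite -mem_enum mem_nth //; case/and3P: bT => _ /eqP->.
have nxt : x != t by apply: contraNneq xmin => ->; rewrite mA.
split=> //; last 2 first.
- by rewrite /gen_min mA.
- by apply/(mem_steps bT); exists i.
split=> //; last first.
  rewrite ltn_neqAle tmin // andbT; apply: contra nxt => /eqP/val_inj->; exact: eqxx.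
apply: contra nxt => xT; have := transversal_self bT il; rewrite -eA set_enum.
move=> /eqP/cards1P[u eu]; have : x \in A :&: val T by rewrite inE xA.
have : t \in A :&: val T by rewrite inE tA.
by rewrite eu !inE => /eqP-> /eqP->.
Qed.

Lemma part_relation (y : part_index M) : is_relation (part_rel R y).
Proof.
case: y => [[[T A] x] h]; have /and3P[/= pA xA nm] := h.
have [t [_ et As tA]] := part_indexP pA xA nm.
split=> [T'|].
  rewrite ffunE /= et; case: eqP => _; first exact: ext_homog_genB.
  by move=> B; rewrite ext_zeroE eqxx.
rewrite (bigD1 T) //= big1 ?addr0 => [|T' /negbTE nT]; last by rewrite ffunE nT mul0r.
by rewrite ffunE eqxx et mulrBl (gen_z_base As xA tA) subrr.
Qed.

(** A predicate rather than a function, because [edge_rel] obtains [a], [b] and [k] by a search; the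
    predicate records the orientation that the search returned. *)
Definition edge_lead_spec (y : edge_index M) (i : nbcb * 'I_n) :=
  exists S a b k, [/\ S \in nbc_of_size M ell.-1, Gamma_edge M S a b k.+1, a != b
    & [/\ val y = (S, [set a; b]), val i.1 = b |: S, i.2 = b
        & edge_rel R y = close_rel R M (flag_of M (insertion S a k.+1))
            (flag_of M (insertion S b k.+2))]].

Lemma edge_lead_exists (y : edge_index M) : exists i, edge_lead_spec y i.
Proof.
case: y => [[S e] h]; have /andP[/= Snbc' /imset2P[a0 b0 _]] := h.
rewrite inE /= => /and4P[a0N b0N n0 /existsP[k0 hk0]] e0.
have nS : S \in nbc_of_size M ell.-1 by move: Snbc'; rewrite inE => /andP[].
rewrite /edge_lead_spec /edge_rel /=.
case: pickP => [[[a b] k] /= /and3P[nab /eqP ee hE]|none].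
  have [_ bN _ _] := edge_props nS hE.
  have [_ _ bS _ _] := memN bN.
  by exists (Sub (b |: S) bS, b), S, a, b, k; split=> //; split=> //; rewrite /= ?ee ?SubK.
(* The search cannot fail, so the default relation [0] never occurs. *)
have [e1|e1] := orP hk0.
  by have := none (a0, b0, k0); rewrite /= n0 e0 eqxx e1.
by have := none (b0, a0, k0); rewrite /= eq_sym n0 e0 setUC eqxx e1.
Qed.

Definition lead_spec (g : edge_index M + part_index M) (i : nbcb * 'I_n) :=
  match g with
  | inl y => edge_lead_spec y i
  | inr y => i = ((val y).1.1, (val y).2)
  end.

(** An edge with [a != b] by itself puts [S] into [nbc'], since [a |: S] and [b |: S] are two nbc
    bases above it. *)
Lemma edge_index_exists S a b k : S \in nbc_of_size M ell.-1 -> Gamma_edge M S a b k.+1 ->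
  a != b -> exists y : edge_index M, val y = (S, [set a; b]).
Proof.
move=> nS eab nab; have [aN bN _ _] := edge_props nS eab.
have [aS _ naS _ _] := memN aN; have [bS _ nbS _ _] := memN bN.
have nab' : a |: S != b |: S.
  apply: contraNneq nab => e; have : a \in b |: S by rewrite -e setU11.
  by rewrite in_setU1 (negbTE aS) orbF.
have kl : (k < ell)%N by move: eab => /and3P[/and4P[_ kl _ _] _ _].
suff h : ((S, [set a; b]).1 \in nbc' M) && ((S, [set a; b]).2 \in t_edges M S).
  by exists (Sub (S, [set a; b]) h).
rewrite /= inE nS /=; apply/andP; split.
  have <- : #|[set a |: S; b |: S]| = 2%N by rewrite cards2 nab'.
  apply/subset_leq_card/subsetP => X; rewrite in_set2 => /orP[/eqP->|/eqP->].
    by rewrite in_set naS subsetUr.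
  by rewrite in_set nbS subsetUr.
apply/imset2P; exists a b => //; rewrite inE /=; apply/and4P; split=> //.
by apply/existsP; exists (Ordinal kl); rewrite eab.
Qed.

Lemma mem_N_setD1 T x : x \in val T ->
  val T :\ x \in nbc_of_size M ell.-1 /\ x \in N M (val T :\ x).
Proof.
move=> xT; have /setIdP[nT /eqP cT] := nbc_baseP T; split.
  rewrite inE (nbcS (subD1set _ _) nT) /=; apply/eqP.
  by have := congr1 predn cT; rewrite (cardsD1 x (val T)) xT.
by rewrite inE setD1K // setD11 nbc_baseP.
Qed.

Lemma setCsetD1 S x : ~: S :\ x = ~: (x |: S).
Proof. by apply/setP => y; rewrite !inE negb_or. Qed.

Lemma relcoord_part_rel (y : part_index M) T x : exists t : 'I_n, [/\ (t < (val y).2)%N &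
  relcoord (part_rel R y) (T, x) =
    if T == (val y).1.1 then (x == (val y).2)%:R - (x == t)%:R else 0].
Proof.
case: y => [[[T0 A] x0] h]; have /and3P[/= pA xA nm] := h.
have [t [[_ _ lt] et _ _]] := part_indexP pA xA nm; exists t; split=> //.
rewrite /relcoord ffunE /= et; case: (T == T0); last by rewrite ext_zeroE.
by rewrite ext_addE ext_oppE !gen1E.
Qed.

Section Lead.
Variable lead : edge_index M + part_index M -> nbcb * 'I_n.
Hypothesis leadP : forall g, lead_spec g (lead g).

(** At a lead [(T, j)], edge relations have [j] in [T] and part relations have [j] outside [T].
    Among the former, [S] is recovered as [T :\ j] and the other endpoint by [edge_unique]; among
    the latter, the part is the one containing [j]. *)
Lemma lead_inj : injective lead.
Proof.
have edge_part (y : edge_index M) (y' : part_index M) : lead (inl y) = lead (inr y') -> False.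
  move=> e; have [S [a [b [k [nS eab nab [vy iT ib _]]]]]] := leadP (inl y).
  have := leadP (inr y'); rewrite -{}e; case: y' => [[[T A] x] h] /= e.
  rewrite {}e /= in iT ib; have /and3P[/= pA xA nm] := h.
  have [t [[_ xT _] _ _ _]] := part_indexP pA xA nm; case/negP: xT.
  by rewrite (iT : val T = b |: S) ib setU11.
case=> [y|y] [y'|y'] e; [|by case: (edge_part _ _ e)|by case: (edge_part _ _ (esym e))|].
  have [S [a [b [k [nS eab nab [vy iT ib _]]]]]] := leadP (inl y).
  have [S' [a' [b' [k' [nS' eab' nab' [vy' iT' ib' _]]]]]] := leadP (inl y').
  rewrite -e {}iT {}ib in iT' ib'; subst b'.
  have [_ bN _ _] := edge_props nS eab; have [bS _ _ _ _] := memN bN.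
  have [_ bN' _ _] := edge_props nS' eab'; have [bS' _ _ _ _] := memN bN'.
  have eS : S = S' by rewrite -(setU1K bS) iT' setU1K.
  subst S'; have ea := edge_unique nS eab eab' nab nab'; subst a'.
  by congr inl; apply: val_inj; rewrite vy vy'.
have := leadP (inr y'); rewrite -e (leadP (inr y)) {e}.
case: y => [[[T A] x] h]; case: y' => [[[T' A'] x'] h'] /= [eT ex]; subst T' x'.
have /and3P[/= pA xA nm] := h; have /and3P[/= pA' xA' nm'] := h'.
have bT := nbc_ordered_base (nbc_baseP T).
have [_ [_ _ + _]] := part_indexP pA xA nm; have [_ [_ _ + _]] := part_indexP pA' xA' nm'.
move=> /(mem_steps bT)[i' _ eA'] /(mem_steps bT)[i _ eA].
congr inr; apply: val_inj => /=; congr (_, _, _).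
have [lt|lt|eii] := ltngtP i i'; last by rewrite eA eA' eii.
  by have /pred0P/(_ x) := step_disjoint M (enum (val T)) lt; rewrite /= -eA -eA' xA xA'.
by have /pred0P/(_ x) := step_disjoint M (enum (val T)) lt; rewrite /= -eA -eA' xA xA'.
Qed.

Lemma lead_outside T x : x \notin val T -> exists g, lead g = (T, x).
Proof.
move=> xT; have bT := nbc_ordered_base (nbc_baseP T); have mT := nbc_min_steps (nbc_baseP T).
have : x \in seq_cover (steps M (enum (val T))) by rewrite (steps_cover M_simple bT) inE.
rewrite inE => /hasP[A /(mem_steps bT)[i il eA] xA].
have pA : A \in parts M (flag_of_base T).
  have lt : ((ell - i).-1 < ell)%N.
    by rewrite prednK ?subn_gt0 // leq_subr.
  apply/imsetP; exists (Ordinal lt) => //=.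
  by rewrite prednK ?subn_gt0 // eA -(part_step bT il).
have nm : Some x != smin A.
  rewrite eA (smin_step bT x mT il); apply: contra xT => /eqP[->].
  by rewrite -mem_enum mem_nth //; case/and3P: bT => _ /eqP->.
have h : [&& (T, A, x).1.2 \in parts M (flag_of_base (T, A, x).1.1),
    (T, A, x).2 \in (T, A, x).1.2 & Some (T, A, x).2 != smin (T, A, x).1.2].
  by rewrite /= pA xA nm.
by exists (inr (Sub (T, A, x) h)); have /= -> := leadP (inr (Sub (T, A, x) h)).
Qed.

Lemma lead_edge T x c k : x \in val T -> Gamma_edge M (val T :\ x) c x k.+1 -> c != x ->
  exists g, lead g = (T, x).
Proof.
move=> xT ecx ncx; have [nS xN] := mem_N_setD1 xT.
have [y vy] := edge_index_exists nS ecx ncx; exists (inl y).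
have [S [a [b [k' [nS' eab nab [vy' iT ib _]]]]]] := leadP (inl y).
move: vy'; rewrite vy => -[eS e2]; subst S.
(* The index only stores the unordered pair; as [c < x] and [a < b], the larger end must be [x] in
   both readings. *)
have [_ _ cx] := edge_lt nS c ecx ncx; have [_ _ ab] := edge_lt nS c eab nab.
have exb : x = b.
  have : x \in [set a; b] by rewrite -e2 set22.
  rewrite !inE => /orP[/eqP exa|/eqP//].
  have : c \in [set a; b] by rewrite -e2 set21.
  rewrite !inE -exa (negbTE ncx) => /eqP ecb.
  by move: cx; rewrite exa ecb ltnNge ltnW.
rewrite (surjective_pairing (lead _)) ib -exb; congr pair; apply: val_inj.
by rewrite iT -exb setD1K.
Qed.

(* The remaining coordinates are indexed by the pairs [(x |: S, x)] with [S] nbc of rank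
   [l - 1] and [x] the root of [t(S)]; they are detected, triangularly in the sum of [S], by
   the coefficients of [\sum_T v T * z_base T] at the complements of the sets [S]. *)
Lemma relation_eq0 (v : {ffun nbcb -> E}) : is_relation v ->
  (forall g, relcoord v (lead g) = 0) -> v = 0.
Proof.
move=> [hv rv] lv.
have supp T x : v T [set x] != 0 -> x \in val T /\
    (forall c k, Gamma_edge M (val T :\ x) c x k.+1 -> c = x).
  move=> nz; have xT : x \in val T.
    by apply: contraNT nz => /lead_outside[g eg]; have := lv g; rewrite eg /relcoord => ->.
  split=> // c k ecx; apply/eqP; apply: contraNT nz => ncx.
  by have [g eg] := lead_edge xT ecx ncx; have := lv g; rewrite eg /relcoord => ->.
suff H k T x : (\sum_(y in val T :\ x) y < k)%N -> v T [set x] = 0.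
  apply/ffunP => T; rewrite [RHS]ffunE; apply/ffunP => A; rewrite ext_zeroE.
  apply/eqP; apply: contraT => nz; have /eqP/cards1P[x eA] := hv _ _ nz.
  by move: nz; rewrite eA (H _ _ _ (ltnSn _)) eqxx.
elim: k T x => // k IHk T x; rewrite ltnS => le.
apply/eqP; apply: contraT => nz; have [xT rx] := supp _ _ nz.
have [nS xN] := mem_N_setD1 xT; set S := val T :\ x in le rx nS xN.
have [xS _ _ _ _] := memN xN.
have gens T' : v T' = \sum_j v T' [set j] *: gen j.
  apply/ffunP => A; rewrite ext_sumE; have [/cards1P[j ->]|nA] := boolP (#|A| == 1%N).
    rewrite (bigD1 j) //= big1 ?addr0 => [|j' nj]; rewrite ext_scaleE gen1E.
      by rewrite eqxx mulr1.
    by rewrite eq_sym (negbTE nj) mulr0.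
  rewrite big1 => [|j _].
    by apply/eqP; apply: contraNT nA => /hv->.
  rewrite ext_scaleE ext_gen_basis ext_basisE; case: eqP => [eA|_]; last by rewrite mulr0.
  by rewrite eA cards1 eqxx in nA.
have := congr1 (fun a : E => a (~: S)) rv; rewrite ext_zeroE ext_sumE.
have termE T' : (v T' * z_base R T') (~: S) =
    \sum_j v T' [set j] * (gen j * z_base R T') (~: S).
  rewrite {1}(gens T') mulr_suml ext_sumE; apply: eq_bigr => j _.
  by rewrite -scalerAl ext_scaleE.
have zero T' j : (T', j) != (T, x) -> v T' [set j] * (gen j * z_base R T') (~: S) = 0.
  move=> ne; apply/eqP; apply: contraT => nz'.
  have nv : v T' [set j] != 0 by apply: contra_neq nz' => ->; rewrite mul0r.
  have [jT' rj] := supp _ _ nv; have [nS' jN] := mem_N_setD1 jT'.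
  have bT' := nbc_ordered_base (nbc_baseP T').
  have mT' := nbc_min_steps (nbc_baseP T').
  move: nz'; rewrite ext_gen_mulE setCsetD1; case: ifP => [|_]; last by rewrite mulr0 eqxx.
  rewrite in_setC => jS nz'.
  have tV : flag_transversal M (enum (val T')) (j |: S).
    rewrite -[j |: S]setCK; apply: (z_neq0 (R := R) bT'); apply: contra_neq nz' => zz.
    by rewrite {1}/z_base /flag_of_base zz !mulr0.
  (* Transversality bounds the sum of [val T' :\ j] by that of [S]. A strict inequality is covered
     by the induction; equality forces [j |: S = val T'], and then [j] and [x] are both roots for
     [S]. *)
  have := transversal_sum M_simple bT' mT' tV; rewrite set_enum sum_setU1 //.
  have -> : (\sum_(y in enum (val T')) y = \sum_(y in val T' :\ j) y + j)%N.
    rewrite -sum_setU1 ?setD11 // setD1K //; apply: eq_bigl => y; exact: mem_enum.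
  rewrite leq_add2r leq_eqVlt => -[/orP[/eqP e|lt] eqT]; last first.
    by rewrite IHk ?eqxx // in nv; apply: leq_trans le.
  have {}eqT : j |: S = val T' by apply: eqT; rewrite e.
  have eS : val T' :\ j = S by rewrite -eqT setU1K.
  rewrite eS in rj jN; have exj := root_unique nS jN xN rj rx; case/eqP: ne.
  by rewrite exj; congr pair; apply: val_inj; rewrite -eqT exj setD1K.
rewrite (bigD1 T) //= [X in _ + X]big1 ?addr0 => [|T' nT']; last first.
  rewrite termE big1 // => j _; apply: zero.
  by apply: contraNneq nT' => -[->].
rewrite termE (bigD1 x) //= [X in _ + X]big1 ?addr0 => [|j nj]; last first.
  by apply: zero; apply: contraNneq nj => -[->].
rewrite ext_gen_mulE setCsetD1 in_setC xS setD1K //.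
have [m ->] := z_base_unit R M_simple T; rewrite mulrC -exprD => /sign_mul_eq0 v0.
by rewrite v0 eqxx in nz.
Qed.

End Lead.

End Main.

Theorem theorem5p7 (R : comNzRingType) (n : nat) (M : matroid n)
    (M_simple : simple_matroid M) :
  is_basis (@is_relation R n M)
    (fun x : edge_index M + part_index M =>
       match x with
       | inl y => edge_rel R y
       | inr y => part_rel R y
       end).
Proof.
have [lead leadP] : exists f : _ -> nbc_base M * 'I_n, forall g, lead_spec R (M := M) g (f g).
  apply: fin_all_exists => -[y|y]; first exact: edge_lead_exists.
  by exists ((val y).1.1, (val y).2).
apply: (triangular_is_basis (cd := @relcoord R n M) (lead := lead) (w := @relweight n M)).
- exact: relcoord_lin.
- case=> [y|y]; last exact: part_relation.
  have [S [a [b [k [nS eab nab [_ _ _ ->]]]]]] := leadP (inl y).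
  by have [] := edge_relation R M_simple nS eab nab.
- exact: is_relation_lin.
- case=> [y|y].
    have [S [a [b [k [nS eab nab [_ iT ib ->]]]]]] := leadP (inl y).
    by rewrite (surjective_pairing (lead _)) ib; apply: edge_lead.
  have /= -> := leadP (inr y).
  have [t [lt ->]] := relcoord_part_rel R y (val y).1.1 (val y).2.
  rewrite !eqxx (_ : ((val y).2 == t) = false) ?subr0 ?mulr1 //.
  by apply/eqP => e; rewrite e ltnn in lt.
- case=> [y|y] i.
    have [S [a [b [k [nS eab nab [_ iT ib ->]]]]]] := leadP (inl y).
    by rewrite [lead _]surjective_pairing ib; apply: edge_above.
  have /= -> := leadP (inr y); case: i => T x; have [t [lt ->]] := relcoord_part_rel R y T x.
  case: (T =P (val y).1.1) => [->|_]; last by rewrite eqxx.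
  have [->|nx] := eqVneq x (val y).2; first by left.
  have [->|nt] := eqVneq x t; last by rewrite subrr eqxx.
  by right; apply: relweight_lt; rewrite /= ltn_add2l ltn_sub2l.
- exact: (lead_inj leadP).
- exact: (relation_eq0 M_simple leadP).
Qed.
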